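(* Let $\mathcal{P}$, with data $(\mathcal{P},\Delta_{\mathcal P},H,B,\iota,(\chi_i,J_i)_{i\in I})$, be a locally trivial quantum principal fibre bundle, let $F$ be a vector space and let $\rho: F\longrightarrow H\otimes F$ be a left $H$-coaction. Then the vector bundle associated to $\mathcal P$ and $\rho$, $$E(\mathcal{P},F)=\{e\in \mathcal{P}\otimes F\;|\;(\Delta_{\mathcal P}\otimes \mathrm{id})(e)=(\mathrm{id}\otimes\rho)(e)\},$$ is a locally trivial quantum vector bundle (over $B$, with typical fibre $F$ and covering $(J_i)_{i\in I}$).
   Context: All algebras are unital associative over a fixed ground field, $\otimes$ is over that field. **Coverings of algebras.** A covering of an algebra $B$ is a finite family $(J_i)_{i\in I}$ of two-sided ideals with $\bigcap_i J_i=0$. Put $B_i=B/J_i$, $B_{ij}=B/(J_i+J_j)$, with canonical projections $\pi_i:B\to B_i$, $\pi^i_j:B_i\to B_{ij}$. The covering completion is $B_c=\{(a_i)_{i}\in\bigoplus_i B_i\,|\,\pi^i_j(a_i)=\pi^j_i(a_j)\ \forall i,j\}$. The covering is complete if $K:B\to B_c$, $K(a)=(\pi_i(a))_i$, is an isomorphism. **Coverings of modules.** A left module $(E,B,\kappa)$ is a vector space $E$, an algebra $B$ and a linear map $\kappa:B\to \mathrm{End}(E)$ with $\kappa(ab)=\kappa(a)\kappa(b)$; it is faithful if $\ker\kappa=0$. A covering of it is a finite family $(Q_i)_{i\in I}$ of submodules with $\bigcap_iQ_i=0$. Put $E_i=E/Q_i$, $q_i:E\to E_i$, $q^i_j:E_i\to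 E/(Q_i+Q_j)$ the canonical projections, $\kappa_i:B\to\mathrm{End}(E_i)$ the induced action, and $E_c=\{(e_i)_i\in\bigoplus_iE_i\,|\,q^i_j(e_i)=q^j_i(e_j)\}$. The covering of a faithful module is complete if $(\ker\kappa_i)_i$ is a complete covering of $B$ and $\mathcal K:E\to E_c$, $\mathcal K(e)=(q_i(e))_i$, is an isomorphism. **Locally trivial quantum vector bundle (QVB).** A tuple $\{(E,B,\kappa),V,(\zeta_i,J_i)_{i\in I}\}$ where $(E,B,\kappa)$ is a faithful left module, $(J_i)_{i\in I}$ is a complete covering of $B$, $V$ is a vector space and $\zeta_i:E\to B_i\otimes V$ are surjective left module homomorphisms, i.e. $\zeta_i(\kappa(a)(e))=\pi_i(a)\zeta_i(e)$ for $a\in B$, $e\in E$, such that $(\ker\zeta_i)_{i\in I}$ is a complete covering of $E$ and $\ker\zeta_i+\ker\zeta_j=\ker((\pi^i_j\otimes \mathrm{id})\circ\zeta_i)=\ker((\pi^j_i\otimes \mathrm{id})\circ\zeta_j)$ for all $i,j$. One denotes such a bundle by $E$. For $E=E(\mathcal P,F)$ the left $B$-action is $\kappa(a)(\sum_k p_k\otimes f_k)=\sum_k \iota(a)p_k\otimes f_k$. **Locally trivial quantum principal fibre bundle (QPFB).** A tuple $(\mathcal{P},\Delta_{\mathcal P},H,B,\iota,(\chi_i,J_i)_{i\in I})$ where $B$ is an algebra, $H$ is a Hopf algebra (comultiplication $\Delta$, counit $\varepsilon$), $\mathcal P$ is a right $H$-comodule algebra with coaction $\Delta_{\mathcal P}:\mathcal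 P\to\mathcal P\otimes H$, $(J_i)_{i\in I}$ is a complete covering of $B$, $\iota:B\to\mathcal P$ is an injective algebra homomorphism with image $\{p\in\mathcal P\,|\,\Delta_{\mathcal P}(p)=p\otimes 1\}$, and $\chi_i:\mathcal P\to B_i\otimes H$ are surjective algebra homomorphisms with $\chi_i(\iota(a))=\pi_i(a)\otimes1$ and $(\chi_i\otimes \mathrm{id})\circ\Delta_{\mathcal P}=(\mathrm{id}\otimes\Delta)\circ\chi_i$, such that $(\ker\chi_i)_{i\in I}$ is a complete covering of $\mathcal P$. One has $\ker\chi_i+\ker\chi_j=\ker((\pi^i_j\otimes\mathrm{id})\circ\chi_i)$, and there are algebra homomorphisms $\tau_{ij}:H\to B_{ij}$ with central values (transition functions) such that, with the algebra isomorphisms $\phi_{ij}:B_{ij}\otimes H\to B_{ij}\otimes H$, $\phi_{ij}(a\otimes h)=\sum a\,\tau_{ji}(h_{(1)})\otimes h_{(2)}$, the bundle $\mathcal P$ is identified via $p\mapsto(\chi_i(p))_i$ with $\{(p_i)_i\in\bigoplus_iB_i\otimes H\,|\,(\pi^i_j\otimes\mathrm{id})(p_i)=\phi_{ij}\circ(\pi^j_i\otimes\mathrm{id})(p_j)\}$.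
   Formalization: The vector space F is assumed to be nonzero; for F = 0 the associated bundle E(P,F) is zero, which is not a faithful B-module unless B = 0, so the statement as printed fails there. *)

(* Defs.v *)
From HB Require Import structures.
From mathcomp Require Import all_boot all_algebra.
From mathcomp Require Import generic_quotient ring_quotient.
From mathcomp Require Import sesquilinear.
From mathcomp Require Import boolp.
From mathcomp Require Import freeg.
Set Implicit Arguments.
Unset Strict Implicit.
Unset Printing Implicit Defensive.
Import GRing.Theory.
Local Open Scope ring_scope.
Local Open Scope quotient_scope.

Section Subspaces.
Variables (k : fieldType) (V : lmodType k).

Section Kernel.
Variables (V' : lmodType k) (f : {linear V -> V'}).
Definition kerp : {pred V} := [pred x | f x == 0].
Lemma kerp_closed : submod_closed kerp.
Proof.
split=> [|a x y]; rewrite !inE ?linear0 ?eqxx //.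
by rewrite linearP => /eqP-> /eqP->; rewrite scaler0 addr0.
Qed.
Definition kersub : submodClosed V :=
  HB.pack kerp (GRing.isSubmodClosed.Build k V kerp kerp_closed).
Lemma kersubE x : (x \in kersub) = (f x == 0).
Proof. by []. Qed.
End Kernel.

Section Sum.
Variables (W1 W2 : submodClosed V).
Definition addp : {pred V} :=
  fun x => `[< exists x1 x2, [/\ x1 \in W1, x2 \in W2 & x = x1 + x2] >].
Lemma addpP x :
  reflect (exists x1 x2, [/\ x1 \in W1, x2 \in W2 & x = x1 + x2]) (x \in addp).
Proof. exact: asboolP. Qed.
Lemma addp_closed : submod_closed addp.
Proof.
split=> [|a _ _ /addpP[x1 [x2 [x1W x2W ->]]] /addpP[y1 [y2 [y1W y2W ->]]]].
  by apply/addpP; exists 0, 0; rewrite !rpred0 addr0.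
apply/addpP; exists (a *: x1 + y1), (a *: x2 + y2).
by split; rewrite ?rpredD ?rpredZ // scalerDr addrACA.
Qed.
Definition addsub : submodClosed V :=
  HB.pack addp (GRing.isSubmodClosed.Build k V addp addp_closed).
Lemma addsubP x :
  reflect (exists x1 x2, [/\ x1 \in W1, x2 \in W2 & x = x1 + x2])
          (x \in addsub).
Proof. exact: asboolP. Qed.
Lemma addsubl : {subset W1 <= addsub}.
Proof. by move=> x xW; apply/addsubP; exists x, 0; rewrite rpred0 addr0. Qed.
Lemma addsubr : {subset W2 <= addsub}.
Proof. by move=> x xW; apply/addsubP; exists 0, x; rewrite rpred0 add0r. Qed.
End Sum.

Section Span.
Variable X : V -> Prop.
Definition spanp : {pred V} :=
  fun x => `[< forall W : submodClosed V, (forall y, X y -> y \in W) -> x \in W >].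
Lemma spanpP x :
  reflect (forall W : submodClosed V, (forall y, X y -> y \in W) -> x \in W)
          (x \in spanp).
Proof. exact: asboolP. Qed.
Lemma spanp_closed : submod_closed spanp.
Proof.
split=> [|a x y /spanpP xX /spanpP yX]; apply/spanpP => W XW.
  exact: rpred0.
by rewrite rpredD ?rpredZ ?xX ?yX.
Qed.
Definition spansub : submodClosed V :=
  HB.pack spanp (GRing.isSubmodClosed.Build k V spanp spanp_closed).
Lemma spansubP x :
  reflect (forall W : submodClosed V, (forall y, X y -> y \in W) -> x \in W)
          (x \in spansub).
Proof. exact: asboolP. Qed.
Lemma mem_spansub x : X x -> x \in spansub.
Proof. by move=> Xx; apply/spansubP => W; apply. Qed.
End Span.

(* A submodClosed predicate over a field is zmodClosed, but has no canonical
   zmodClosed structure. *)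
Definition zpred (W : submodClosed V) : {pred V} := W.
Lemma zpred_closed W : zmod_closed (zpred W).
Proof.
by split=> [|x y xW yW]; rewrite /zpred ?rpred0 // rpredD // -scaleN1r rpredZ.
Qed.
HB.instance Definition _ W :=
  GRing.isZmodClosed.Build V (zpred W) (zpred_closed W).

End Subspaces.

Section QuotientSpace.
Variables (k : fieldType) (V : lmodType k) (W : submodClosed V).

Definition cosets := Quotient.quot (zpred W).
HB.instance Definition _ := GRing.Zmodule.on cosets.

Definition coset_proj (x : V) : cosets := \pi_(Quotient.quot (zpred W)) x.

Lemma coset_proj_eq x y : coset_proj x = coset_proj y <-> x - y \in W.
Proof.
rewrite /coset_proj; split=> [/eqP|xyW]; first by rewrite -Quotient.idealrBE.
by apply/eqP; rewrite -Quotient.idealrBE.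
Qed.

Definition coset_repr (x : cosets) : V := repr x.
Lemma coset_proj_repr (x : cosets) : coset_proj (coset_repr x) = x.
Proof. exact: reprK. Qed.

Lemma coset_projD : {morph coset_proj : x y / x + y}.
Proof.
by move=> x y; rewrite /coset_proj (raddfD (\pi_(Quotient.quot (zpred W)))).
Qed.

Definition coset_scale (a : k) (x : cosets) : cosets := coset_proj (a *: coset_repr x).

Lemma coset_scaleE a x : coset_scale a (coset_proj x) = coset_proj (a *: x).
Proof.
apply/coset_proj_eq; rewrite -scalerBr rpredZ //.
by apply/coset_proj_eq; rewrite coset_proj_repr.
Qed.

Lemma coset_scalerA a b v : coset_scale a (coset_scale b v) = coset_scale (a * b) v.
Proof. by rewrite -[v]coset_proj_repr !coset_scaleE scalerA. Qed.
Lemma coset_scale1r : left_id 1 coset_scale.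
Proof. by move=> v; rewrite -[v]coset_proj_repr !coset_scaleE scale1r. Qed.
Lemma coset_scalerDr : right_distributive coset_scale +%R.
Proof.
move=> a u v; rewrite -[u]coset_proj_repr -[v]coset_proj_repr -coset_projD.
by rewrite !coset_scaleE -coset_projD scalerDr.
Qed.
Lemma coset_scalerDl v : {morph coset_scale^~ v : a b / a + b}.
Proof.
by move=> a b; rewrite -[v]coset_proj_repr !coset_scaleE -coset_projD scalerDl.
Qed.
HB.instance Definition _ := GRing.Zmodule_isLmodule.Build k cosets
  coset_scalerA coset_scale1r coset_scalerDr coset_scalerDl.

Lemma coset_proj_linear : linear coset_proj.
Proof. by move=> a x y; rewrite coset_projD -coset_scaleE. Qed.

HB.instance Definition _ :=
  GRing.isLinear.Build k V cosets *:%R coset_proj coset_proj_linear.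

Record quotient := MkQuotient {
  quotient_space : lmodType k;
  quotient_proj : {linear V -> quotient_space};
  quotient_repr : quotient_space -> V;
  quotient_eq :
    forall x y, quotient_proj x = quotient_proj y <-> x - y \in W;
  quotient_reprK : cancel quotient_repr quotient_proj
}.
End QuotientSpace.

(* The quotient space V / W, with its projection and a choice of
   representatives. The lock keeps unification from unfolding the cosets. *)
Fact quotient_key : unit. Proof. exact: tt. Qed.
Definition quotient_of (k : fieldType) (V : lmodType k) (W : submodClosed V) :
    quotient W :=
  locked_with quotient_key
    (MkQuotient (@coset_proj_eq k V W) (@coset_proj_repr k V W)).

Section QuotientTheory.
Variables (k : fieldType) (V : lmodType k) (W : submodClosed V).
Definition quotv : lmodType k := quotient_space (quotient_of W).
Definition qproj : V -> quotv := quotient_proj (quotient_of W).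
Definition qrepr : quotv -> V := @quotient_repr _ _ _ (quotient_of W).
HB.instance Definition _ := GRing.Linear.on qproj.

Lemma qproj_eq x y : qproj x = qproj y <-> x - y \in W.
Proof. exact: quotient_eq. Qed.
Lemma qproj_repr x : qproj (qrepr x) = x.
Proof. exact: quotient_reprK. Qed.
Lemma repr_qproj x : qrepr (qproj x) - x \in W.
Proof. by apply/qproj_eq; rewrite qproj_repr. Qed.
End QuotientTheory.

Section QuotientLift.
Variables (k : fieldType) (V : lmodType k) (W : submodClosed V).

Lemma qproj_eq0 x : (qproj W x == 0) = (x \in W).
Proof. by apply/eqP/idP; rewrite -(linear0 (qproj W)) qproj_eq subr0. Qed.

Variables (V' : lmodType k) (f : {linear V -> V'}).
Definition qlift of {subset W <= kersub f} := fun x : quotv W => f (qrepr x).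
Variable Wf : {subset W <= kersub f}.
Lemma qliftE x : qlift Wf (qproj W x) = f x.
Proof.
apply/eqP; rewrite -subr_eq0 -linearB.
by rewrite -kersubE; apply/Wf/repr_qproj.
Qed.
Lemma qlift_linear : linear (qlift Wf).
Proof.
move=> a x y; rewrite -[x]qproj_repr -[y]qproj_repr -linearP !qliftE.
exact: linearP.
Qed.
HB.instance Definition _ :=
  GRing.isLinear.Build k (quotv W) V' *:%R (qlift Wf) qlift_linear.
End QuotientLift.

(* For a family W, the projection V / W i -> V / (W i + W j) is
   projl (W i) (W j), and V / W j -> V / (W i + W j) is projr (W i) (W j): both
   have the same codomain, whereas addsub (W j) (W i) is another predicate. *)
Section PairProjections.
Variables (k : fieldType) (V : lmodType k) (W1 W2 : submodClosed V).
Lemma ker_projl : {subset W1 <= kersub (qproj (addsub W1 W2))}.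
Proof. by move=> x xW; rewrite kersubE qproj_eq0 addsubl. Qed.
Lemma ker_projr : {subset W2 <= kersub (qproj (addsub W1 W2))}.
Proof. by move=> x xW; rewrite kersubE qproj_eq0 addsubr. Qed.
Definition projl : quotv W1 -> quotv (addsub W1 W2) := qlift ker_projl.
Definition projr : quotv W2 -> quotv (addsub W1 W2) := qlift ker_projr.
HB.instance Definition _ := GRing.Linear.on projl.
HB.instance Definition _ := GRing.Linear.on projr.
End PairProjections.
Arguments projl {k V} W1 W2 _.
Arguments projr {k V} W1 W2 _.

Section Covering.
Variables (k : fieldType) (I : finType) (V : lmodType k).
Variable W : I -> submodClosed V.

Definition covering := forall x, (forall i, x \in W i) -> x = 0.

Definition completion :=
  {v : forall i, quotv (W i) |
    forall i j, projl (W i) (W j) (v i) = projr (W i) (W j) (v j)}.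

Lemma completion_map_subproof x i j :
  projl (W i) (W j) (qproj (W i) x) = projr (W i) (W j) (qproj (W j) x).
Proof. by rewrite /projl /projr !qliftE. Qed.

Definition completion_map (x : V) : completion :=
  exist _ (fun i => qproj (W i) x) (completion_map_subproof x).

(* The operations of the completion are componentwise, so that completion_map
   is a homomorphism (of algebras if the W i are ideals, of modules if they are
   submodules), and it is an isomorphism iff it is bijective. *)
Definition complete_covering := covering /\ bijective completion_map.

End Covering.

Section Tensor.
Variables (k : fieldType) (U V : lmodType k).

Local Notation free := {freeg (U * V)%type / k}.
Local Notation gen u v := (Freeg [:: (1 : k, (u, v) : (U * V)%type)] : free).

Inductive tensor_relation : free -> Prop :=
| TensorDl u u' v : tensor_relation (gen (u + u') v - (gen u v + gen u' v))
| TensorDr u v v' : tensor_relation (gen u (v + v') - (gen u v + gen u v'))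
| TensorZl a u v : tensor_relation (gen (a *: u) v - a *: gen u v)
| TensorZr a u v : tensor_relation (gen u (a *: v) - a *: gen u v).

Definition tensor : lmodType k := quotv (spansub tensor_relation).

Definition tens (u : U) (v : V) : tensor := qproj _ (gen u v).

Lemma tens_bilinear : bilinear_for *:%R *:%R tens.
Proof.
have tE x y : tensor_relation (x - y) ->
    qproj (spansub tensor_relation) x = qproj (spansub tensor_relation) y.
  by move=> xy; apply/qproj_eq/mem_spansub.
have tDl x y v : tens (x + y) v = tens x v + tens y v.
  by rewrite /tens (tE _ _ (TensorDl x y v)) linearD.
have tDr u x y : tens u (x + y) = tens u x + tens u y.
  by rewrite /tens (tE _ _ (TensorDr u x y)) linearD.
have tZl a u v : tens (a *: u) v = a *: tens u v.
  by rewrite /tens (tE _ _ (TensorZl a u v)) linearZ.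
have tZr a u v : tens u (a *: v) = a *: tens u v.
  by rewrite /tens (tE _ _ (TensorZr a u v)) linearZ.
by split=> [v a x y|u a x y]; rewrite ?tDl ?tDr ?tZl ?tZr.
Qed.

HB.instance Definition _ :=
  bilinear_isBilinear.Build k U V tensor *:%R *:%R tens tens_bilinear.

Lemma tensDl u u' v : tens (u + u') v = tens u v + tens u' v.
Proof. exact: linearDl. Qed.
Lemma tensDr u v v' : tens u (v + v') = tens u v + tens u v'.
Proof. exact: linearDr. Qed.
Lemma tensZl a u v : tens (a *: u) v = a *: tens u v.
Proof. exact: linearZl_LR. Qed.
Lemma tensZr a u v : tens u (a *: v) = a *: tens u v.
Proof. exact: linearZr_LR. Qed.

Lemma tens_ind (P : tensor -> Prop) :
  (forall u v, P (tens u v)) -> (forall s t, P s -> P t -> P (s + t)) ->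
  forall t, P t.
Proof.
move=> P1 PD t; have P0 : P 0.
  by have := P1 0 0; rewrite -[in tens _ _](scale0r 0) tensZl scale0r.
rewrite -[t]qproj_repr -[qrepr t]freeg_sumE linear_sum /=.
elim/big_ind: _ => // -[u v] _; move: (coeff _ _) => a.
suff -> : Freeg [:: (a, (u, v))] = a *: gen u v.
  by rewrite linearZ /= -/(tens u v) -tensZl.
by apply/eqP/freeg_eqP => x; rewrite coeffZ !coeffU mulrA mulr1.
Qed.

Lemma tens_ext (W : lmodType k) (f g : {linear tensor -> W}) :
  (forall u v, f (tens u v) = g (tens u v)) -> f =1 g.
Proof. by move=> fg; elim/tens_ind => // s t; rewrite !linearD => -> ->. Qed.

Section TensorLift.
Variables (W : lmodType k) (f : U -> V -> W).

Definition free_lift (x : free) : W := fglift (fun p => f p.1 p.2) x.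

Lemma free_lift_linear : linear free_lift.
Proof.
have fB : {morph free_lift : x y / x - y}.
  by move=> x y; apply: lift_is_additive.
pose M := HB.pack_for {additive free -> W} free_lift
  (GRing.isZmodMorphism.Build free W free_lift fB).
have fD x y : free_lift (x + y) = free_lift x + free_lift y.
  exact: (raddfD M).
have fU a p : free_lift (Freeg [:: (a, p)]) = a *: f p.1 p.2.
  exact: liftU.
have fS (r : seq (U * V)) F : free_lift (\sum_(p <- r) F p) =
                             \sum_(p <- r) free_lift (F p).
  exact: (raddf_sum M).
move=> a x y; rewrite fD; congr (_ + _).
have xE : free_lift x = \sum_(p <- dom x) coeff p x *: f p.1 p.2.
  by rewrite -[in LHS](freeg_sumE x) fS; apply: eq_bigr => p _; rewrite fU.
have axE : a *: x = \sum_(p <- dom x) Freeg [:: (a * coeff p x, p)].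
  rewrite -[in LHS](freeg_sumE x) scaler_sumr; apply: eq_bigr => p _.
  by apply/eqP/freeg_eqP => q; rewrite coeffZ !coeffU mulrA.
rewrite axE fS xE scaler_sumr; apply: eq_bigr => p _.
by rewrite fU scalerA.
Qed.
HB.instance Definition _ :=
  GRing.isLinear.Build k free W *:%R free_lift free_lift_linear.

Lemma free_liftE u v : free_lift (gen u v) = f u v.
Proof. by rewrite /free_lift liftU scale1r. Qed.

Hypothesis bf : bilinear_for *:%R *:%R f.

Lemma tensor_lift_subproof :
  {subset spansub tensor_relation <= kersub free_lift}.
Proof.
have [lf rf] := bf.
have fDl v x y : f (x + y) v = f x v + f y v.
  by have := lf v 1 x y; rewrite /= !scale1r.
have fDr u x y : f u (x + y) = f u x + f u y.
  by have := rf u 1 x y; rewrite /= !scale1r.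
have fZl v a x : f (a *: x) v = a *: f x v.
  have f0 : f 0 v = 0 by apply: (addIr (f 0 v)); rewrite -fDl !add0r.
  by have := lf v a x 0; rewrite /= f0 !addr0.
have fZr u a x : f u (a *: x) = a *: f u x.
  have f0 : f u 0 = 0 by apply: (addIr (f u 0)); rewrite -fDr !add0r.
  by have := rf u a x 0; rewrite /= f0 !addr0.
move=> x /spansubP; apply=> {}x [] *; rewrite kersubE linearB /= subr_eq0.
- by rewrite linearD /= !free_liftE fDl.
- by rewrite linearD /= !free_liftE fDr.
- by rewrite linearZ /= !free_liftE fZl.
- by rewrite linearZ /= !free_liftE fZr.
Qed.

Definition tensor_lift : tensor -> W := qlift tensor_lift_subproof.
HB.instance Definition _ := GRing.Linear.on tensor_lift.

Lemma tensor_liftE u v : tensor_lift (tens u v) = f u v.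
Proof. by rewrite /tensor_lift qliftE /= free_liftE. Qed.

End TensorLift.
End Tensor.

Section TensorMap.
Variables (k : fieldType) (U V U' V' : lmodType k).
Variables (f : {linear U -> U'}) (g : {linear V -> V'}).

Lemma tensor_map_subproof :
  bilinear_for *:%R *:%R (fun u v => tens (f u) (g v)).
Proof.
by split=> [v a x y|u a x y] /=; rewrite linearP ?tensDl ?tensDr ?tensZl ?tensZr.
Qed.

Definition tensor_map : tensor U V -> tensor U' V' :=
  tensor_lift tensor_map_subproof.
HB.instance Definition _ := GRing.Linear.on tensor_map.

Lemma tensor_mapE u v : tensor_map (tens u v) = tens (f u) (g v).
Proof. exact: tensor_liftE. Qed.
End TensorMap.

Section TensorAssociator.
Variables (k : fieldType) (U V W : lmodType k).

Lemma tensorA_subproof1 w :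
  bilinear_for *:%R *:%R (fun (u : U) (v : V) => tens u (tens v w : tensor V W)).
Proof.
by split=> [v a x y|u a x y] /=; rewrite ?(tensDl, tensDr, tensZl, tensZr).
Qed.

Lemma tensorA_subproof2 :
  bilinear_for *:%R *:%R (fun t w => tensor_lift (tensorA_subproof1 w) t).
Proof.
split=> [w a s t|t a x y] /=; first exact: linearP.
elim/tens_ind: t => [u v|s t IHs IHt].
  by rewrite !tensor_liftE !(tensDr, tensZr).
by rewrite !linearD /= IHs IHt addrACA.
Qed.

Definition tensorA : tensor (tensor U V) W -> tensor U (tensor V W) :=
  tensor_lift tensorA_subproof2.
HB.instance Definition _ := GRing.Linear.on tensorA.

Lemma tensorAE u v w : tensorA (tens (tens u v) w) = tens u (tens v w).
Proof. by rewrite /tensorA !tensor_liftE. Qed.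
End TensorAssociator.

Section TensorUnit.
Variables (k : fieldType) (V : lmodType k).

Lemma tensor1l_subproof : bilinear_for *:%R *:%R (fun (c : k^o) (v : V) => c *: v).
Proof.
split=> [v a x y|c a x y] /=; first by rewrite scalerDl scalerA.
by rewrite scalerDr !scalerA mulrC.
Qed.
Definition tensor1l : tensor k^o V -> V := tensor_lift tensor1l_subproof.
HB.instance Definition _ := GRing.Linear.on tensor1l.
Lemma tensor1lE c v : tensor1l (tens c v) = c *: v.
Proof. exact: tensor_liftE. Qed.

Lemma tensor1r_subproof : bilinear_for *:%R *:%R (fun (v : V) (c : k^o) => c *: v).
Proof.
split=> [c a x y|v a x y] /=; last by rewrite scalerDl scalerA.
by rewrite scalerDr !scalerA mulrC.
Qed.
Definition tensor1r : tensor V k^o -> V := tensor_lift tensor1r_subproof.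
HB.instance Definition _ := GRing.Linear.on tensor1r.
Lemma tensor1rE v c : tensor1r (tens v c) = c *: v.
Proof. exact: tensor_liftE. Qed.
End TensorUnit.

(* Unital associative algebras, the zero algebra included: the algebras of a
   covering are arbitrary quotients, whereas algType requires 1 != 0. *)
Record algebra (k : fieldType) := Algebra {
  alg_space :> lmodType k;
  aone : alg_space;
  amul : alg_space -> alg_space -> alg_space;
  amulA : associative amul;
  amul1l : left_id aone amul;
  amul1r : right_id aone amul;
  amul_bilinear : bilinear_for *:%R *:%R amul
}.
Arguments aone {k _}.

Infix "**" := amul (at level 40, left associativity) : ring_scope.

Section AlgebraTheory.
Variables (k : fieldType) (A : algebra k).
Implicit Types (c : k) (x y z : A).

Lemma amulDl x y z : (x + y) ** z = x ** z + y ** z.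
Proof. by have := (amul_bilinear A).1 z 1 x y; rewrite /= !scale1r. Qed.
Lemma amulDr x y z : x ** (y + z) = x ** y + x ** z.
Proof. by have := (amul_bilinear A).2 x 1 y z; rewrite /= !scale1r. Qed.
Lemma amul0l x : 0 ** x = 0.
Proof. by apply: (addIr (0 ** x)); rewrite -amulDl !add0r. Qed.
Lemma amul0r x : x ** 0 = 0.
Proof. by apply: (addIr (x ** 0)); rewrite -amulDr !add0r. Qed.
Lemma amulZl c x y : (c *: x) ** y = c *: (x ** y).
Proof. by have := (amul_bilinear A).1 y c x 0; rewrite /= amul0l !addr0. Qed.
Lemma amulZr c x y : x ** (c *: y) = c *: (x ** y).
Proof. by have := (amul_bilinear A).2 x c y 0; rewrite /= amul0r !addr0. Qed.

Definition lmul x : A -> A := amul x.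
Lemma lmul_linear x : linear (lmul x).
Proof. by move=> c y z; rewrite /lmul amulDr amulZr. Qed.
HB.instance Definition _ x :=
  GRing.isLinear.Build k A A *:%R (lmul x) (lmul_linear x).

Definition mul_map : tensor A A -> A := tensor_lift (amul_bilinear A).
HB.instance Definition _ := GRing.Linear.on mul_map.
Lemma mul_mapE x y : mul_map (tens x y) = x ** y.
Proof. exact: tensor_liftE. Qed.

End AlgebraTheory.

Lemma regular_bilinear (k : fieldType) :
  bilinear_for *:%R *:%R (fun x y : k^o => (x * y : k^o)).
Proof.
split=> [y a x x'|x a y y'] /=; first by rewrite mulrDl scalerAl.
by rewrite mulrDr scalerAr.
Qed.
Definition regular_algebra (k : fieldType) : algebra k :=
  @Algebra k k^o 1 *%R (@mulrA k) (@mul1r k) (@mulr1 k) (@regular_bilinear k).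

Definition algebra_morphism (k : fieldType) (A B : algebra k)
    (f : {linear A -> B}) : Prop :=
  f aone = aone /\ {morph f : x y / x ** y}.

Section TensorAlgebra.
Variables (k : fieldType) (A B : algebra k).
Implicit Types s t u : tensor A B.

Lemma tensor_mul_subproof t :
  bilinear_for *:%R *:%R (fun a b => tensor_map (lmul (a : A)) (lmul (b : B)) t).
Proof.
split=> [b c x y|a c x y] /=; elim/tens_ind: t => [a' b'|s t IHs IHt].
- by rewrite !tensor_mapE /= /lmul amulDl tensDl amulZl tensZl.
- by rewrite !linearD /= IHs IHt addrACA.
- by rewrite !tensor_mapE /= /lmul amulDl tensDr amulZl tensZr.
- by rewrite !linearD /= IHs IHt addrACA.
Qed.

Definition tensor_mul s t : tensor A B := tensor_lift (tensor_mul_subproof t) s.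
Definition tensor_one : tensor A B := tens aone aone.

Lemma tensor_mulE a b a' b' :
  tensor_mul (tens a b) (tens a' b') = tens (a ** a') (b ** b').
Proof. by rewrite /tensor_mul tensor_liftE tensor_mapE. Qed.

Lemma tensor_mulDl : left_distributive tensor_mul +%R.
Proof. by move=> s t u; rewrite /tensor_mul linearD. Qed.

Lemma tensor_mul_linear s : linear (tensor_mul s).
Proof.
move=> c t u; elim/tens_ind: s => [a b|s s' IHs IHs'].
  by rewrite /tensor_mul !tensor_liftE linearP.
by rewrite !tensor_mulDl IHs IHs' scalerDr addrACA.
Qed.

Lemma tensor_mul_bilinear : bilinear_for *:%R *:%R tensor_mul.
Proof.
by split=> [t c s s'|s]; [rewrite /tensor_mul /= linearP|exact: tensor_mul_linear].
Qed.

Lemma tensor_mulDr : right_distributive tensor_mul +%R.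
Proof.
by move=> s t u; have := tensor_mul_linear s 1 t u; rewrite !scale1r.
Qed.

Lemma tensor_mulA : associative tensor_mul.
Proof.
move=> s t u; elim/tens_ind: s => [a b|? ? IH1 IH2]; last first.
  by rewrite !tensor_mulDl IH1 IH2.
elim/tens_ind: t => [a' b'|? ? IH1 IH2]; last first.
  by rewrite !(tensor_mulDr, tensor_mulDl) IH1 IH2.
elim/tens_ind: u => [a'' b''|? ? IH1 IH2]; last first.
  by rewrite !tensor_mulDr IH1 IH2.
by rewrite !tensor_mulE !amulA.
Qed.

Lemma tensor_mul1l : left_id tensor_one tensor_mul.
Proof.
elim/tens_ind => [a b|? ? IH1 IH2]; first by rewrite tensor_mulE !amul1l.
by rewrite tensor_mulDr IH1 IH2.
Qed.

Lemma tensor_mul1r : right_id tensor_one tensor_mul.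
Proof.
elim/tens_ind => [a b|? ? IH1 IH2]; first by rewrite tensor_mulE !amul1r.
by rewrite tensor_mulDl IH1 IH2.
Qed.

Canonical tensor_algebra : algebra k := Algebra
  tensor_mulA tensor_mul1l tensor_mul1r tensor_mul_bilinear.

Lemma tensM (a a' : A) (b b' : B) :
  tens a b ** tens a' b' = tens (a ** a') (b ** b').
Proof. exact: tensor_mulE. Qed.
End TensorAlgebra.

Record ideal (k : fieldType) (B : algebra k) := Ideal {
  ideal_sub :> submodClosed B;
  idealMl : forall b x, x \in ideal_sub -> b ** x \in ideal_sub;
  idealMr : forall b x, x \in ideal_sub -> x ** b \in ideal_sub
}.

Section QuotientAlgebra.
Variables (k : fieldType) (B : algebra k) (J : ideal B).

Definition quot_mul (x y : quotv J) : quotv J := qproj J (qrepr x ** qrepr y).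

Lemma quot_mulE x y : quot_mul (qproj J x) (qproj J y) = qproj J (x ** y).
Proof.
rewrite /quot_mul; set x' := qrepr _; set y' := qrepr _; apply/qproj_eq.
have -> : x' ** y' - x ** y = (x' - x) ** y' + x ** (y' - y).
  rewrite amulDl amulDr -!scaleN1r amulZl amulZr !scaleN1r.
  by rewrite addrA subrK.
by apply: rpredD; [apply: idealMr|apply: idealMl]; apply: repr_qproj.
Qed.

Lemma quot_mulA : associative quot_mul.
Proof.
move=> x y z; rewrite -[x]qproj_repr -[y]qproj_repr -[z]qproj_repr.
by rewrite !quot_mulE amulA.
Qed.
Lemma quot_mul1l : left_id (qproj J aone) quot_mul.
Proof. by move=> x; rewrite -[x]qproj_repr quot_mulE amul1l. Qed.
Lemma quot_mul1r : right_id (qproj J aone) quot_mul.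
Proof. by move=> x; rewrite -[x]qproj_repr quot_mulE amul1r. Qed.
Lemma quot_mul_bilinear : bilinear_for *:%R *:%R quot_mul.
Proof.
split=> [z a x y|x a y z] /=.
  rewrite -[x]qproj_repr -[y]qproj_repr -[z]qproj_repr -linearP /= !quot_mulE.
  by rewrite amulDl amulZl linearP.
rewrite -[x]qproj_repr -[y]qproj_repr -[z]qproj_repr -linearP /= !quot_mulE.
by rewrite amulDr amulZr linearP.
Qed.
Canonical quot_algebra : algebra k := Algebra
  quot_mulA quot_mul1l quot_mul1r quot_mul_bilinear.

Lemma qprojM x y : qproj J (x ** y) = qproj J x ** qproj J y.
Proof. by rewrite -quot_mulE. Qed.
Lemma qproj_morphism : algebra_morphism (qproj J).
Proof. by split=> //; exact: qprojM. Qed.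
End QuotientAlgebra.

(* lm_act is a linear and multiplicative map B -> End(E), not assumed to be
   unital. *)
Record leftModule (k : fieldType) (B : algebra k) := LeftModule {
  lm_space :> lmodType k;
  lm_act : B -> lm_space -> lm_space;
  lm_act_bilinear : bilinear_for *:%R *:%R lm_act;
  lm_actM : forall a b e, lm_act (a ** b) e = lm_act a (lm_act b e)
}.

Section LeftModuleTheory.
Variables (k : fieldType) (B : algebra k) (E : leftModule B).
Implicit Types (a b : B) (e : E).

Lemma lm_act_linear a : linear (lm_act a : E -> E).
Proof. by case: (@lm_act_bilinear _ _ E) => _; apply. Qed.
HB.instance Definition _ a :=
  GRing.isLinear.Build k E E *:%R (lm_act a) (lm_act_linear a).

Definition ker_actp : {pred B} := fun b => `[< forall e, lm_act b e = 0 >].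
Lemma ker_actp_closed : submod_closed ker_actp.
Proof.
have linl := (@lm_act_bilinear _ _ E).1.
have act0 e : lm_act 0 e = 0.
  apply: (addIr (lm_act 0 e)); have := linl e 1 0 0.
  by rewrite /= !scale1r addr0 => <-; rewrite add0r.
split=> [|a x y /asboolP x0 /asboolP y0]; apply/asboolP => // e.
by have := linl e a x y; rewrite /= x0 y0 scaler0 addr0.
Qed.
Definition ker_act : submodClosed B :=
  HB.pack ker_actp (GRing.isSubmodClosed.Build k B ker_actp ker_actp_closed).
Lemma ker_actP b : reflect (forall e, lm_act b e = 0) (b \in ker_act).
Proof. exact: asboolP. Qed.

Definition faithful := forall b, b \in ker_act -> b = 0.

Record submodule := Submodule {
  sm_sub :> submodClosed E;
  sm_act : forall a e, e \in sm_sub -> lm_act a e \in sm_sub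
}.

Section QuotientModule.
Variable Q : submodule.

Definition quot_act a (x : quotv Q) : quotv Q := qproj Q (lm_act a (qrepr x)).

Lemma quot_actE a e : quot_act a (qproj Q e) = qproj Q (lm_act a e).
Proof. by apply/qproj_eq; rewrite -linearB sm_act ?repr_qproj. Qed.

Lemma quot_act_bilinear : bilinear_for *:%R *:%R quot_act.
Proof.
split=> [x c a b|a c x y] /=.
  rewrite -[x]qproj_repr !quot_actE -linearP /=; congr qproj.
  exact: (@lm_act_bilinear _ _ E).1.
by rewrite -[x]qproj_repr -[y]qproj_repr -linearP !quot_actE !linearP.
Qed.
Lemma quot_actM a b x : quot_act (a ** b) x = quot_act a (quot_act b x).
Proof. by rewrite -[x]qproj_repr !quot_actE lm_actM. Qed.

Definition quot_module : leftModule B := LeftModule quot_act_bilinear quot_actM.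
End QuotientModule.

End LeftModuleTheory.

Definition complete_module_covering (k : fieldType) (B : algebra k)
    (E : leftModule B) (I : finType) (Q : I -> submodule E) :=
  complete_covering (fun i => ker_act (quot_module (Q i))) /\
  complete_covering Q.

Section ModuleHomomorphism.
Variables (k : fieldType) (B : algebra k) (E E' : leftModule B).

Record moduleHom := ModuleHom {
  mh_linear :> {linear E -> E'};
  mh_act : forall a e, mh_linear (lm_act a e) = lm_act a (mh_linear e)
}.

Lemma ker_moduleHom_subproof (f : moduleHom) a e :
  e \in kersub f -> lm_act a e \in kersub f.
Proof. by rewrite !kersubE mh_act => /eqP->; rewrite linear0. Qed.
Definition ker_moduleHom (f : moduleHom) : submodule E :=
  Submodule (@ker_moduleHom_subproof f).
End ModuleHomomorphism.

(* (B / J) \otimes V, on which B acts through B / J *)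
Section TrivialModule.
Variables (k : fieldType) (B : algebra k) (J : ideal B) (V : lmodType k).

Definition trivial_act (a : B) : tensor (quotv J) V -> tensor (quotv J) V :=
  tensor_map (lmul (qproj J a)) idfun.

Lemma trivial_act_bilinear : bilinear_for *:%R *:%R trivial_act.
Proof.
split=> [t c a b|a c s t] /=; last by rewrite /trivial_act linearP.
rewrite /trivial_act; elim/tens_ind: t => [x v|s t IHs IHt].
  by rewrite !tensor_mapE /= /lmul linearP amulDl amulZl tensDl tensZl.
by rewrite !(linearD (tensor_map _ _)) /= IHs IHt scalerDr addrACA.
Qed.
Lemma trivial_actM a b t : trivial_act (a ** b) t = trivial_act a (trivial_act b t).
Proof.
rewrite /trivial_act; elim/tens_ind: t => [x v|s t IHs IHt].
  by rewrite !tensor_mapE /= /lmul qprojM amulA.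
by rewrite !linearD /= IHs IHt.
Qed.
Definition trivial_module : leftModule B :=
  LeftModule trivial_act_bilinear trivial_actM.
End TrivialModule.

(* Quantum vector bundle with total space E, typical fibre V, covering J of the
   base B and trivialisations zeta; projl (J i) (J j) and projr (J i) (J j) are
   the projections of B / J i and B / J j to B / (J i + J j). *)
Record locally_trivial_QVB (k : fieldType) (I : finType) (B : algebra k)
    (E : leftModule B) (V : lmodType k) (J : I -> ideal B)
    (zeta : forall i, moduleHom E (trivial_module (J i) V)) : Prop := {
  qvb_faithful : faithful E;
  qvb_base : complete_covering J;
  qvb_surj : forall i y, exists e, zeta i e = y;
  qvb_covering : complete_module_covering (fun i => ker_moduleHom (zeta i));
  qvb_kerl : forall i j,
    addsub (kersub (zeta i)) (kersub (zeta j)) =i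
    kersub (tensor_map (projl (J i) (J j)) idfun \o zeta i);
  qvb_kerr : forall i j,
    addsub (kersub (zeta i)) (kersub (zeta j)) =i
    kersub (tensor_map (projr (J i) (J j)) idfun \o zeta j)
}.

Record hopfAlgebra (k : fieldType) := HopfAlgebra {
  hopf_sort :> algebra k;
  comul : {linear hopf_sort -> tensor hopf_sort hopf_sort};
  counit : {linear hopf_sort -> k^o};
  antipode : {linear hopf_sort -> hopf_sort};
  comul_morphism : algebra_morphism comul;
  counit_morphism : algebra_morphism (B := regular_algebra k) counit;
  comulA : forall h,
    tensorA (tensor_map comul idfun (comul h)) = tensor_map idfun comul (comul h);
  counitl : forall h, tensor1l (tensor_map counit idfun (comul h)) = h;
  counitr : forall h, tensor1r (tensor_map idfun counit (comul h)) = h;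
  antipodel : forall h,
    mul_map (tensor_map antipode idfun (comul h)) = (counit h : k) *: aone;
  antipoder : forall h,
    mul_map (tensor_map idfun antipode (comul h)) = (counit h : k) *: aone
}.

Definition right_coaction (k : fieldType) (H : hopfAlgebra k) (M : lmodType k)
    (delta : {linear M -> tensor M H}) : Prop :=
  (forall m, tensorA (tensor_map delta idfun (delta m)) =
             tensor_map idfun (comul H) (delta m)) /\
  (forall m, tensor1r (tensor_map idfun (counit H) (delta m)) = m).

Definition left_coaction (k : fieldType) (H : hopfAlgebra k) (M : lmodType k)
    (rho : {linear M -> tensor H M}) : Prop :=
  (forall m, tensorA (tensor_map (comul H) idfun (rho m)) =
             tensor_map idfun rho (rho m)) /\
  (forall m, tensor1l (tensor_map (counit H) idfun (rho m)) = m).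

Record locally_trivial_QPFB (k : fieldType) (I : finType) := QPFB {
  qpfb_total : algebra k;
  qpfb_hopf : hopfAlgebra k;
  qpfb_base : algebra k;
  qpfb_coact : {linear qpfb_total -> tensor qpfb_total qpfb_hopf};
  qpfb_iota : {linear qpfb_base -> qpfb_total};
  qpfb_ideal : I -> ideal qpfb_base;
  qpfb_chi : forall i,
    {linear qpfb_total -> tensor (quotv (qpfb_ideal i)) qpfb_hopf};
  qpfb_coactP : right_coaction qpfb_coact;
  qpfb_coact_morphism : algebra_morphism qpfb_coact;
  qpfb_base_covering : complete_covering qpfb_ideal;
  qpfb_iota_morphism : algebra_morphism qpfb_iota;
  qpfb_iota_inj : injective qpfb_iota;
  qpfb_iota_image : forall p,
    (exists a, qpfb_iota a = p) <-> qpfb_coact p = tens p aone;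
  qpfb_chi_morphism : forall i, algebra_morphism (qpfb_chi i);
  qpfb_chi_surj : forall i y, exists p, qpfb_chi i p = y;
  qpfb_chi_iota : forall i a,
    qpfb_chi i (qpfb_iota a) = tens (qproj (qpfb_ideal i) a) aone;
  qpfb_chi_coact : forall i p,
    tensorA (tensor_map (qpfb_chi i) idfun (qpfb_coact p)) =
    tensor_map idfun (comul qpfb_hopf) (qpfb_chi i p);
  qpfb_total_covering : complete_covering (fun i => kersub (qpfb_chi i))
}.

(* E(P, F), as a left module over the base of P *)
Section AssociatedBundle.
Variables (k : fieldType) (I : finType) (P : locally_trivial_QPFB k I).
Variables (F : lmodType k) (rho : {linear F -> tensor (qpfb_hopf P) F}).

Definition assocp : {pred tensor (qpfb_total P) F} :=
  [pred e | tensorA (tensor_map (qpfb_coact P) idfun e) ==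
            tensor_map idfun rho e].
Lemma assocp_closed : submod_closed assocp.
Proof.
split=> [|c x y]; rewrite !inE ?linear0 // => /eqP xP /eqP yP.
by rewrite !linearP /= xP yP.
Qed.
HB.instance Definition _ :=
  GRing.isSubmodClosed.Build k (tensor (qpfb_total P) F) assocp assocp_closed.

Definition assoc_space := {e : tensor (qpfb_total P) F | e \in assocp}.
HB.instance Definition _ := SubChoice.on assoc_space.
HB.instance Definition _ := [SubChoice_isSubZmodule of assoc_space by <:].
HB.instance Definition _ := [SubZmodule_isSubLmodule of assoc_space by <:].

Definition assoc_mul (a : qpfb_base P) :
    tensor (qpfb_total P) F -> tensor (qpfb_total P) F :=
  tensor_map (lmul (qpfb_iota P a)) idfun.

Lemma assoc_mul_bilinear : bilinear_for *:%R *:%R assoc_mul.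
Proof.
split=> [t c a b|a c s t] /=; last by rewrite /assoc_mul linearP.
rewrite /assoc_mul; elim/tens_ind: t => [x v|s t IHs IHt].
  by rewrite !tensor_mapE /= /lmul linearP amulDl amulZl tensDl tensZl.
by rewrite !(linearD (tensor_map _ _)) /= IHs IHt scalerDr addrACA.
Qed.

Lemma assoc_mulM a b t : assoc_mul (a ** b) t = assoc_mul a (assoc_mul b t).
Proof.
rewrite /assoc_mul; elim/tens_ind: t => [x v|s t IHs IHt].
  by rewrite !tensor_mapE /= /lmul (qpfb_iota_morphism P).2 amulA.
by rewrite !linearD /= IHs IHt.
Qed.

Lemma assoc_mul_closed a e : e \in assocp -> assoc_mul a e \in assocp.
Proof.
have iotaa : qpfb_coact P (qpfb_iota P a) = tens (qpfb_iota P a) aone.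
  by apply/qpfb_iota_image; exists a.
set b := qpfb_iota P a in iotaa *.
have lmulA (t : tensor (qpfb_total P) (qpfb_hopf P)) (f : F) :
    tensorA (tens (tens b aone ** t) f) =
    tensor_map (lmul b) idfun (tensorA (tens t f)).
  elim/tens_ind: t => [p h|s t IHs IHt].
    by rewrite tensM amul1l !tensorAE tensor_mapE.
  by rewrite amulDr !tensDl !linearD /= IHs IHt.
have coactE e' : tensorA (tensor_map (qpfb_coact P) idfun (assoc_mul a e')) =
    tensor_map (lmul b) idfun (tensorA (tensor_map (qpfb_coact P) idfun e')).
  rewrite /assoc_mul -/b; elim/tens_ind: e' => [p f|s t IHs IHt].
    rewrite !tensor_mapE /= /lmul (qpfb_coact_morphism P).2 iotaa.
    exact: lmulA.
  by rewrite !linearD /= IHs IHt.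
have rhoE e' : tensor_map idfun rho (assoc_mul a e') =
    tensor_map (lmul b) idfun (tensor_map idfun rho e').
  rewrite /assoc_mul -/b; elim/tens_ind: e' => [p f|s t IHs IHt].
    by rewrite !tensor_mapE.
  by rewrite !linearD /= IHs IHt.
by rewrite !inE coactE rhoE => /eqP->.
Qed.

Definition assoc_act (a : qpfb_base P) (e : assoc_space) : assoc_space :=
  exist _ (assoc_mul a (val e)) (assoc_mul_closed a (valP e)).

Lemma assoc_act_bilinear : bilinear_for *:%R *:%R assoc_act.
Proof.
split=> [e c a b|a c e e']; apply: val_inj => /=.
  exact: assoc_mul_bilinear.1.
exact: assoc_mul_bilinear.2.
Qed.
Lemma assoc_actM a b e : assoc_act (a ** b) e = assoc_act a (assoc_act b e).
Proof. by apply: val_inj; rewrite /= assoc_mulM. Qed.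

Definition assoc_bundle : leftModule (qpfb_base P) :=
  LeftModule assoc_act_bilinear assoc_actM.
End AssociatedBundle.

(* Main.v *)
Require Import Defs.
From HB Require Import structures.
From mathcomp Require Import all_boot all_algebra.
From mathcomp Require Import sesquilinear boolp classical_sets.
Set Implicit Arguments.
Unset Strict Implicit.
Unset Printing Implicit Defensive.
Import GRing.Theory.
Local Open Scope ring_scope.

(** The trivialisations of the associated bundle E are
    zeta_i = (beta_i (x) id) restricted to E, where beta_i = (id (x) eps) chi_i
    (base_part).  Since chi_i is colinear, chi_i = (beta_i (x) id) delta, and on E this gives
    (chi_i (x) id) = (id (x) rho) zeta_i: on E the kernel of zeta_i is that of
    chi_i (x) id.  So the theorem says that the cotensor product with F is exact
    enough on the ideals ker chi_i of the total algebra A.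

    The reason for exactness is a total integral: a unital colinear map
    phi : H -> A (ex_total_integral).  Modulo each ker chi_i one exists, because
    B_i (x) H receives h |-> 1 (x) h; these local integrals are patched, one
    index at a time, into an integral on A.  A total integral yields a colinear
    retraction lam : A (x) H -> A of the coaction,
    lam (p (x) h) = p_0 phi (S (p_1) h), which preserves every ker chi_i
    (ex_colinear_retraction), hence a linear projection T of A (x) F onto E
    which preserves every ker chi_i (x) F (ex_assoc_projection).

    The projection T does the work.  Surjectivity of zeta_i: lift the element
    of B_i (x) H (x) F that corresponds to the target, then apply T.
    Completeness: local sections glue in A (x) F because tensoring over a field
    keeps the covering (ker chi_i) complete, and T moves the glued element into
    E.  For F = k the same retraction shows that beta_i maps ker chi_j into the
    image of J_j (ker_chi_base_part); together with surjectivity and B-linearity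
    this computes ker zeta_i + ker zeta_j (ker_zeta_sum).  Finally B / J_i acts
    faithfully on B_i (x) F because F is not zero, so the annihilators of the
    local pieces are the J_i themselves.

    Exactness of the tensor product itself comes from the fact that every linear
    map f over a field has a linear g with f g f = f. *)

(* Simplification would replace products and units of the tensor and quotient
   algebras by their underlying functions. *)
Arguments amul : simpl never.
Arguments aone : simpl never.

(** * Linear maps over a field *)

Lemma ex_linear (k : fieldType) (U V : lmodType k) (f : U -> V) :
  linear f -> exists g : {linear U -> V}, g =1 f.
Proof.
move=> f_lin.
pose g : {linear U -> V} := HB.pack f (GRing.isLinear.Build k U V *:%R f f_lin).
by exists g.
Qed.

Lemma addsubC (k : fieldType) (V : lmodType k) (W1 W2 : submodClosed V) :
  addsub W1 W2 =i addsub W2 W1.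
Proof.
by move=> x; apply/addsubP/addsubP=> -[x1 [x2 [x1W x2W ->]]];
   exists x2, x1; rewrite addrC.
Qed.

Section Complement.
Variables (k : fieldType) (V : lmodType k).

Lemma ex_submod (p : V -> Prop) :
  p 0 -> (forall a x y, p x -> p y -> p (a *: x + y)) ->
  exists W : submodClosed V, forall x, x \in W <-> p x.
Proof.
move=> p0 pP; pose q : {pred V} := fun x => `[< p x >].
have q_closed : submod_closed q.
  split=> [|a x y /asboolP px /asboolP py]; apply/asboolP => //.
  exact: pP.
pose W : submodClosed V :=
  HB.pack q (GRing.isSubmodClosed.Build k V q q_closed).
by exists W => x; split=> [/asboolP|px]; last exact/asboolP.
Qed.

(** Zorn's lemma is applied to the sets that are closed under linear
    combinations and meet W at most in 0.  The empty set is among them, so that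
    unions of chains need no special case; 0 is added to the maximal set
    afterwards. *)
Lemma ex_complement (W : submodClosed V) :
  exists C : submodClosed V,
    (forall x, x \in C -> x \in W -> x = 0) /\
    (forall x, exists c, c \in C /\ x - c \in W).
Proof.
pose P (X : set V) := (forall a x y, X x -> X y -> X (a *: x + y)) /\
                      (forall x, X x -> x \in W -> x = 0).
have [|A [[A_closed AW] A_max]] := @Zorn_bigcup V P.
  move=> F FP F_tot; split=> [a x y [X FX Xx] [Y FY Yy]|x [X FX Xx]]; last first.
    exact: (FP X FX).2.
  have [XY|YX] := F_tot X Y FX FY.
    by exists Y => //; apply: (FP Y FY).1 => //; apply: XY.
  by exists X => //; apply: (FP X FX).1 => //; apply: YX.
have [||C CE] := @ex_submod (fun x => A x \/ x = 0); first by right.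
  move=> a x y [Ax|->] [Ay|->]; last by right; rewrite scaler0 addr0.
  - by left; apply: A_closed.
  (* A may not contain 0, so a x is written as (a - 1) x + x. *)
  - left; rewrite addr0 -(subrK 1 a) scalerDl scale1r.
    exact: A_closed.
  - by left; rewrite scaler0 add0r.
have CW x : x \in C -> x \in W -> x = 0 by move/CE=> [/AW|].
(* A vector v outside C + W could be added to the maximal set. *)
exists C; split=> // v; apply: contrapT => v_out.
have v_out' c a : c \in C -> a *: v + c \in W -> a = 0.
  move=> cC avW; apply/eqP/negP => /negP a0; apply: v_out.
  exists (- a^-1 *: c); rewrite rpredZ //; split=> //.
  by rewrite -[v](scalerK a0) scaleNr opprK -scalerDr rpredZ.
apply: (A_max (fun x => exists2 c, c \in C & exists a, x = a *: v + c)).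
  split=> [x Ax|BA].
    by exists x; [apply/CE; left|exists 0; rewrite scale0r add0r].
  have Av : A v.
    by apply: BA; exists 0; rewrite ?rpred0 //; exists 1; rewrite scale1r addr0.
  by apply: v_out; exists v; rewrite subrr rpred0; split=> //; apply/CE; left.
split=> [a _ _ [c cC [b ->]] [c' c'C [b' ->]]|_ [c cC [a ->]] avW].
  exists (a *: c + c'); first by rewrite rpredD ?rpredZ.
  by exists (a * b + b'); rewrite scalerDr scalerA addrACA scalerDl.
have a0 := v_out' _ _ cC avW; move: avW; rewrite a0 scale0r add0r.
exact: CW.
Qed.

End Complement.

Section PseudoInverse.
Variables (k : fieldType) (U V : lmodType k) (f : {linear U -> V}).

(** Complements of the kernel and of the image make f a bijection between a
    complement of its kernel and its image; g inverts it there and kills the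
    complement of the image. *)
Lemma ex_pseudo_inverse :
  exists g : {linear V -> U}, forall u, f (g (f u)) = f u.
Proof.
have [||W WE] := @ex_submod k V (fun v => exists u, f u = v).
- by exists 0; rewrite linear0.
- by move=> a _ _ [x <-] [y <-]; exists (a *: x + y); rewrite linearP.
have [C [C0 Csum]] := ex_complement (kersub f).
have [D [D0 Dsum]] := ex_complement W.
pose R v u := u \in C /\ v - f u \in D.
have R_ex v : exists u, R v u.
  have [d [dD /WE[u fu]]] := Dsum v; have [c [cC]] := Csum u.
  rewrite kersubE linearB subr_eq0 => /eqP fuc.
  by exists c; rewrite /R -fuc fu opprB addrC subrK.
have R_uniq v u u' : R v u -> R v u' -> u = u'.
  move=> [uC vuD] [u'C vu'D]; apply/subr0_eq/C0.
    by rewrite rpredD // -scaleN1r rpredZ.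
  rewrite kersubE; apply/eqP/D0; last by apply/WE; exists (u - u').
  have -> : f (u - u') = (-1) *: (v - f u) + (v - f u').
    by rewrite linearB scaleN1r opprB addrA subrK.
  by rewrite rpredD ?rpredZ.
have [g gR] := choice R_ex.
have [a x y|h hE] := @ex_linear k V U g.
  apply: (R_uniq _ _ _ (gR _)); split; first by rewrite rpredD ?rpredZ ?(gR _).1.
  rewrite linearP opprD addrACA -scalerBr.
  by rewrite rpredD ?rpredZ ?(gR _).2.
exists h => u; rewrite hE; apply/subr0_eq/D0; last first.
  by apply/WE; exists (g (f u) - u); rewrite linearB.
rewrite -opprB -scaleN1r rpredZ //; exact: (gR (f u)).2.
Qed.

End PseudoInverse.

(** * Tensor products and complete coverings *)

Section TensorMapTheory.
Variable k : fieldType.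
Implicit Types U V W : lmodType k.

Lemma tensor_map_comp U V U' V' U'' V'' (f : {linear U' -> U''})
    (g : {linear V' -> V''}) (f' : {linear U -> U'}) (g' : {linear V -> V'}) t :
  tensor_map f g (tensor_map f' g' t) = tensor_map (f \o f') (g \o g') t.
Proof.
elim/tens_ind: t => [u v|s t IHs IHt]; first by rewrite !tensor_mapE.
by rewrite !linearD /= IHs IHt.
Qed.

Lemma tensor_map_compl U V U' U'' (f : {linear U' -> U''})
    (f' : {linear U -> U'}) (t : tensor U V) :
  tensor_map (f \o f') idfun t = tensor_map f idfun (tensor_map f' idfun t).
Proof.
elim/tens_ind: t => [u v|s t IHs IHt]; first by rewrite !tensor_mapE.
by rewrite !linearD /= IHs IHt.
Qed.

Lemma eq_tensor_map U V U' V' (f f' : {linear U -> U'})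
    (g g' : {linear V -> V'}) t :
  f =1 f' -> g =1 g' -> tensor_map f g t = tensor_map f' g' t.
Proof.
move=> ff' gg'; elim/tens_ind: t => [u v|s t IHs IHt].
  by rewrite !tensor_mapE ff' gg'.
by rewrite !linearD /= IHs IHt.
Qed.

Lemma tensor_map_id U V (t : tensor U V) : tensor_map idfun idfun t = t.
Proof.
elim/tens_ind: t => [u v|s t IHs IHt]; first by rewrite tensor_mapE.
by rewrite linearD /= IHs IHt.
Qed.

Lemma tensor_mapDl U V U' V' (f f' : {linear U -> U'}) (g : {linear V -> V'}) t :
  tensor_map (f \+ f') g t = tensor_map f g t + tensor_map f' g t.
Proof.
elim/tens_ind: t => [u v|s t IHs IHt]; first by rewrite !tensor_mapE -tensDl.
by rewrite !linearD /= IHs IHt addrACA.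
Qed.

Lemma tensor_mapBl U V U' V' (f f' : {linear U -> U'}) (g : {linear V -> V'}) t :
  tensor_map (f \- f') g t = tensor_map f g t - tensor_map f' g t.
Proof.
apply/eqP; rewrite eq_sym subr_eq -tensor_mapDl; apply/eqP/eq_tensor_map => //.
by move=> u /=; rewrite subrK.
Qed.

Lemma tensA_subproof1 U V W (u : U) :
  bilinear_for *:%R *:%R (fun (v : V) (w : W) => tens (tens u v : tensor U V) w).
Proof.
by split=> [w a x y|v a x y] /=; rewrite ?(tensDl, tensDr, tensZl, tensZr).
Qed.

Lemma tensA_subproof2 U V W :
  bilinear_for *:%R *:%R (fun u t => tensor_lift (@tensA_subproof1 U V W u) t).
Proof.
split=> [t a x y|u a s t] /=; last exact: linearP.
elim/tens_ind: t => [v w|s t IHs IHt].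
  by rewrite !tensor_liftE !(tensDl, tensZl).
by rewrite !linearD /= IHs IHt addrACA.
Qed.

Definition tensorAV U V W : tensor U (tensor V W) -> tensor (tensor U V) W :=
  tensor_lift (@tensA_subproof2 U V W).
HB.instance Definition _ U V W := GRing.Linear.on (@tensorAV U V W).

Lemma tensorAVE U V W (u : U) (v : V) (w : W) :
  tensorAV (tens u (tens v w)) = tens (tens u v) w.
Proof. by rewrite /tensorAV !tensor_liftE. Qed.

Lemma tensorAVK U V W : cancel (@tensorAV U V W) (@tensorA k U V W).
Proof.
elim/tens_ind => [u t|s t IHs IHt]; last by rewrite !linearD /= IHs IHt.
elim/tens_ind: t => [v w|s t IHs IHt]; first by rewrite tensorAVE tensorAE.
by rewrite tensDr !linearD /= IHs IHt.
Qed.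

Lemma tensorAK U V W : cancel (@tensorA k U V W) (@tensorAV U V W).
Proof.
elim/tens_ind => [t w|s t IHs IHt]; last by rewrite !linearD /= IHs IHt.
elim/tens_ind: t => [u v|s t IHs IHt]; first by rewrite tensorAE tensorAVE.
by rewrite tensDl !linearD /= IHs IHt.
Qed.

Lemma tensorA_map U V W U' V' W' (f : {linear U -> U'}) (g : {linear V -> V'})
    (h : {linear W -> W'}) t :
  tensorA (tensor_map (tensor_map f g) h t) =
  tensor_map f (tensor_map g h) (tensorA t).
Proof.
elim/tens_ind: t => [t w|s t IHs IHt]; last by rewrite !linearD /= IHs IHt.
elim/tens_ind: t => [u v|s t IHs IHt].
  by rewrite !tensor_mapE /= !tensor_mapE !tensorAE !tensor_mapE /= tensor_mapE.
by rewrite tensDl !linearD /= IHs IHt.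
Qed.

Lemma tensorAV_map U V W U' V' W' (f : {linear U -> U'}) (g : {linear V -> V'})
    (h : {linear W -> W'}) t :
  tensorAV (tensor_map f (tensor_map g h) t) =
  tensor_map (tensor_map f g) h (tensorAV t).
Proof. by rewrite -{1}[t]tensorAVK -tensorA_map tensorAK. Qed.

End TensorMapTheory.

Section Exactness.
Variable k : fieldType.

(** The elements of U (x) V killed by all f i (x) id are sums of tensors u (x) v
    with u in the common kernel: there is an endomorphism e of U with values in
    that kernel such that e (x) id fixes all those elements.  It is built by
    adding one index at a time, with a pseudo-inverse g of f i e:
    e is replaced by e (1 - g f i e). *)
Lemma tensor_exact (I : finType) (U V W : lmodType k) (X : I -> lmodType k)
    (f : forall i, {linear U -> X i}) (G : {linear tensor U V -> W}) :
  (forall u v, (forall i, f i u = 0) -> G (tens u v) = 0) ->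
  forall t, (forall i, tensor_map (f i) idfun t = 0) -> G t = 0.
Proof.
move=> G0 t ft0.
have [e [fe0 et]] : exists e : {linear U -> U},
    (forall i u, i \in enum I -> f i (e u) = 0) /\ tensor_map e idfun t = t.
  elim: (enum I) => [|i s [e [fe0 et]]].
    by exists idfun; split=> //; rewrite tensor_map_id.
  have [g gK] := ex_pseudo_inverse (f i \o e).
  exists (e \o (idfun \- (g \o (f i \o e)))); split=> [j u|].
    rewrite inE => /predU1P[->|js] /=; last exact: fe0.
    by rewrite !linearB /=; move: (gK u) => /= ->; rewrite subrr.
  rewrite tensor_map_compl tensor_mapBl tensor_map_id !tensor_map_compl /=.
  by rewrite et ft0 linear0 subr0.
rewrite -et; elim/tens_ind: {ft0 et}t => [u v|s t IHs IHt].
  by rewrite tensor_mapE G0 // => i; rewrite fe0 ?mem_enum.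
by rewrite !linearD /= IHs IHt addr0.
Qed.

Lemma tensor_exact1 (U V W X : lmodType k) (f : {linear U -> X})
    (G : {linear tensor U V -> W}) :
  (forall u v, f u = 0 -> G (tens u v) = 0) ->
  forall t, tensor_map f idfun t = 0 -> G t = 0.
Proof.
move=> G0 t ft0; apply: (@tensor_exact unit _ _ _ _ (fun=> f)) => //.
by move=> u v fu0; apply/G0/fu0/tt.
Qed.

Lemma tensor_ker_le (U U' V X : lmodType k) (f : {linear U -> X})
    (h : {linear U -> U'}) :
  (forall u, f u = 0 -> h u = 0) ->
  forall t : tensor U V, tensor_map f idfun t = 0 -> tensor_map h idfun t = 0.
Proof.
move=> fh; apply: tensor_exact1 => u v /fh hu.
by rewrite /= tensor_mapE hu linear0l.
Qed.

(** A pseudo-inverse of c |-> c v is a linear form with value 1 at v. *)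
Lemma tens_eq0 (U V : lmodType k) (u : U) (v : V) :
  v <> 0 -> tens u v = 0 -> u = 0.
Proof.
move=> v0 uv0; have [|m mE] := @ex_linear k k^o V (fun c => c *: v).
  by move=> a x y; rewrite scalerDl scalerA.
have [l lK] := ex_pseudo_inverse m.
have lv : l v = 1.
  have := lK 1; rewrite !mE scale1r => /eqP.
  rewrite -subr_eq0 -[X in _ - X]scale1r -scalerBl scaler_eq0 subr_eq0.
  by case/orP=> /eqP.
have := congr1 (fun t => tensor1r (tensor_map idfun l t)) uv0.
by rewrite /= tensor_mapE !linear0 tensor1rE lv scale1r.
Qed.

End Exactness.

Section CompleteCoverings.
Variables (k : fieldType) (I : finType).

(** Phrased with representatives, completeness depends on the subspaces only
    through their elements. *)
Lemma complete_coveringP (V : lmodType k) (W : I -> submodClosed V) :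
  complete_covering W <->
  covering W /\
  forall x : I -> V, (forall i j, x i - x j \in addsub (W i) (W j)) ->
    exists y, forall i, y - x i \in W i.
Proof.
split=> [[W0 [g gK Kg]]|[W0 glue]]; split=> //.
  move=> x x_compat.
  have v_compat i j : projl (W i) (W j) (qproj (W i) (x i)) =
                      projr (W i) (W j) (qproj (W j) (x j)).
    by rewrite /projl /projr !qliftE; apply/qproj_eq.
  pose v : completion W := exist _ (fun i => qproj (W i) (x i)) v_compat.
  exists (g v) => i; apply/qproj_eq.
  exact: (congr1 (fun w : completion W => sval w i) (Kg v)).
have K_inj : injective (completion_map W).
  move=> x y xy; apply/subr0_eq/W0 => i; apply/qproj_eq.
  exact: (congr1 (fun w : completion W => sval w i) xy).
have K_surj (v : completion W) : exists y, completion_map W y = v.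
  case: v => v v_compat; have [|y yP] := glue (fun i => qrepr (v i)).
    move=> i j; apply/qproj_eq; have := v_compat i j.
    by rewrite -{1}[v i]qproj_repr -{1}[v j]qproj_repr /projl /projr !qliftE.
  exists y; apply: eq_exist; apply: functional_extensionality_dep => i.
  by rewrite -[RHS]qproj_repr; apply/qproj_eq.
have [g gK] := choice K_surj.
by exists g => // x; apply: K_inj; rewrite gK.
Qed.

Lemma eq_complete_covering (V : lmodType k) (W W' : I -> submodClosed V) :
  (forall i, W i =i W' i) -> complete_covering W -> complete_covering W'.
Proof.
move=> WW' /complete_coveringP[W0 glue]; apply/complete_coveringP; split.
  by move=> x xW'; apply: W0 => i; rewrite WW'.
move=> x x_compat; have [|y yW] := glue x; last by exists y => i; rewrite -WW'.
move=> i j; have /addsubP[x1 [x2 [x1W x2W ->]]] := x_compat i j.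
by apply/addsubP; exists x1, x2; rewrite !WW'.
Qed.

(** Gluing becomes a linear map on the space D of all families: m i is an
    endomorphism of V with kernel W i, so that u : y |-> (m i y)_i embeds V in D
    up to the intersection of the W i, and a pseudo-inverse of u composed with
    x |-> (m i (x i))_i glues every compatible family.  Tensoring this map with
    F glues families in V (x) F, because compatibility is the vanishing of
    linear maps on D. *)
Lemma tensor_glue (V F : lmodType k) (W : I -> submodClosed V)
    (t : I -> tensor V F) :
  complete_covering W ->
  (forall i j, tensor_map (qproj (addsub (W i) (W j))) idfun (t i - t j) = 0) ->
  exists t', forall i, tensor_map (qproj (W i)) idfun (t' - t i) = 0.
Proof.
move=> /complete_coveringP[_ glue] t_compat; pose D : lmodType k := {ffun I -> V}.
pose m i : {linear V -> V} :=
  sval (cid (ex_pseudo_inverse (qproj (W i)))) \o qproj (W i).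
have m_eq i x y : x - y \in W i -> m i x = m i y.
  by move=> /qproj_eq xy; rewrite /= xy.
have m_W i x y : m i x = m i y -> x - y \in W i.
  move=> /= mxy; apply/qproj_eq.
  rewrite -(svalP (cid (ex_pseudo_inverse (qproj (W i)))) x) /= mxy.
  exact: (svalP (cid (ex_pseudo_inverse (qproj (W i)))) y).
have [|u uE] := @ex_linear k V D (fun x => [ffun i => m i x]).
  by move=> a x y; apply/ffunP=> i; rewrite !ffunE linearP.
have [|M ME] := @ex_linear k D D (fun x => [ffun i => m i (x i)]).
  by move=> a x y; apply/ffunP=> i; rewrite !ffunE linearP.
have in_ex i : exists f : {linear V -> D},
    f =1 fun x => [ffun j => if j == i then x else 0].
  apply: ex_linear => a x y; apply/ffunP=> j; rewrite !ffunE.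
  by case: eqP => _; rewrite ?scaler0 ?addr0.
have pr_ex i : exists f : {linear D -> V}, f =1 fun x => x i.
  by apply: ex_linear => a x y; rewrite !ffunE.
have [in_ inE] := choice in_ex; have [pr prE] := choice pr_ex.
have [w wK] := ex_pseudo_inverse u.
(* The family t, seen in D (x) F. *)
pose T := \sum_i tensor_map (in_ i) idfun (t i).
have TE i : tensor_map (pr i) idfun T = t i.
  rewrite linear_sum (bigD1 i) //= -tensor_map_compl big1 => [|j ji].
    rewrite addr0 -[RHS]tensor_map_id; apply: eq_tensor_map => // x /=.
    by rewrite prE inE ffunE eqxx.
  rewrite -tensor_map_compl; elim/tens_ind: (t j) => [x f|x y IHx IHy].
    by rewrite tensor_mapE /= prE inE ffunE eq_sym (negPf ji) linear0l.
  by rewrite linearD /= IHx IHy addr0.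
exists (tensor_map (w \o M) idfun T) => i; apply/eqP.
rewrite -[t i]TE -tensor_mapBl -tensor_map_compl; apply/eqP.
apply: (@tensor_exact k (I * I)%type D F _ _
  (fun ij => qproj (addsub (W ij.1) (W ij.2)) \o (pr ij.1 \- pr ij.2))
  (tensor_map (qproj (W i) \o ((w \o M) \- pr i)) idfun)).
  move=> x f /= x_compat; rewrite tensor_mapE /=.
  have [i1 i2|y yW] := glue x.
    by have /eqP := x_compat (i1, i2); rewrite /= !prE qproj_eq0.
  have MxE : M x = u y.
    rewrite ME uE; apply/ffunP=> j; rewrite !ffunE; apply/esym/m_eq/yW.
  suff -> : qproj (W i) (w (M x) - pr i x) = 0 by rewrite linear0l.
  apply/eqP; rewrite qproj_eq0 prE; apply: m_W.
  have := congr1 (fun z : D => z i) (wK y).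
  rewrite -MxE uE ME !ffunE; apply.
move=> [i1 i2]; rewrite tensor_map_compl tensor_mapBl !TE; exact: t_compat.
Qed.

End CompleteCoverings.

(** * Comodule algebras and retractions of the coaction *)

Section AlgebraLemmas.
Variable k : fieldType.

Definition rmul (A : algebra k) (y x : A) : A := x ** y.
Lemma rmul_linear (A : algebra k) (y : A) : linear (rmul y).
Proof. by move=> c x z; rewrite /rmul amulDl amulZl. Qed.
HB.instance Definition _ (A : algebra k) (y : A) :=
  GRing.isLinear.Build k A A *:%R (rmul y) (rmul_linear y).

Lemma tensor_map_mull (A C D : algebra k) (f : {linear A -> C}) :
  algebra_morphism f ->
  {morph (tensor_map f (@idfun D) : tensor A D -> tensor C D) : s t / s ** t}.
Proof.
move=> [_ fM] s t; elim/tens_ind: s => [a b|s s' IHs IHs']; last first.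
  by rewrite amulDl !linearD /= amulDl IHs IHs'.
elim/tens_ind: t => [a' b'|t t' IHt IHt'].
  by rewrite tensM !tensor_mapE tensM /= fM.
by rewrite amulDr !linearD /= amulDr IHt IHt'.
Qed.

Lemma mul_map_morphism (A C : algebra k) (f : {linear A -> C}) t :
  algebra_morphism f -> f (mul_map t) = mul_map (tensor_map f f t).
Proof.
move=> [_ fM]; elim/tens_ind: t => [a b|s t IHs IHt].
  by rewrite tensor_mapE !mul_mapE fM.
by rewrite !linearD /= IHs IHt.
Qed.

Lemma tensorAVM (A C D : algebra k) (a a' : A) (t t' : tensor C D) :
  tensorAV (tens a t) ** tensorAV (tens a' t') = tensorAV (tens (a ** a') (t ** t')).
Proof.
elim/tens_ind: t => [c d|s t IHs IHt]; last first.
  by rewrite amulDl !tensDr !linearD /= amulDl IHs IHt.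
elim/tens_ind: t' => [c' d'|s t IHs IHt]; last first.
  by rewrite amulDr !tensDr !linearD /= amulDr IHs IHt.
by rewrite tensM !tensorAVE !tensM.
Qed.

End AlgebraLemmas.

Section ComoduleAlgebra.
Variables (k : fieldType) (H : hopfAlgebra k) (A : algebra k).
Variable delta : {linear A -> tensor A H}.
Hypothesis delta_coaction : right_coaction delta.
Hypothesis delta_morphism : algebra_morphism delta.

(** p (x) h |-> p_0 (x) f (p_1) h.  The cases of the identity and of the antipode
    are inverse to each other. *)
Definition twist (f : {linear H -> H}) : tensor A H -> tensor A H :=
  tensor_map idfun (@mul_map k H) \o
    (@tensorA k A H H \o tensor_map (tensor_map idfun f \o delta) idfun).
HB.instance Definition _ f := GRing.Linear.on (twist f).

Lemma twistE f p h :
  twist f (tens p h) = tensor_map idfun f (delta p) ** tens aone h.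
Proof.
rewrite /twist /= tensor_mapE /=.
elim/tens_ind: (delta p) => [q g|s t IHs IHt].
  by rewrite !tensor_mapE tensorAE tensor_mapE /= mul_mapE tensM amul1r.
by rewrite linearD /= tensDl amulDl !linearD /= IHs IHt.
Qed.

Lemma twistK (f g : {linear H -> H}) :
  (forall h, mul_map (tensor_map f g (comul H h)) = (counit H h : k) *: aone) ->
  cancel (twist g) (twist f).
Proof.
move=> fg; elim/tens_ind => [p h|s t IHs IHt]; last by rewrite !linearD /= IHs IHt.
pose Psi : {linear tensor A (tensor H H) -> tensor A H} :=
  tensor_map idfun (rmul h \o (@mul_map k H \o tensor_map f g)).
have PsiE u : twist f (tensor_map idfun g u ** tens aone h) =
              Psi (tensorA (tensor_map delta idfun u)).
  elim/tens_ind: u => [q x|s t IHs IHt]; last first.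
    by rewrite !linearD /= amulDl !linearD /= -IHs -IHt.
  rewrite !tensor_mapE tensM amul1r twistE /=.
  elim/tens_ind: (delta q) => [r y|s t IHs IHt].
    rewrite tensorAE !tensor_mapE tensM amul1r /= tensor_mapE mul_mapE.
    by rewrite /rmul amulA.
  by rewrite tensDl !linearD /= amulDl IHs IHt.
rewrite twistE PsiE delta_coaction.1.
transitivity (tens (tensor1r (tensor_map idfun (counit H) (delta p))) h).
  elim/tens_ind: (delta p) => [q x|s t IHs IHt].
    rewrite !tensor_mapE /= tensor_mapE /= fg tensor1rE /rmul amulZl amul1l.
    by rewrite tensZl tensZr.
  rewrite !linearD tensDl; exact: (congr2 +%R IHs IHt).
by rewrite delta_coaction.2.
Qed.

Lemma twist_idK : cancel (twist idfun) (twist (antipode H)).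
Proof. by apply: twistK => h; exact: antipodel. Qed.

Lemma twist_antipodeK : cancel (twist (antipode H)) (twist idfun).
Proof. by apply: twistK => h; exact: antipoder. Qed.

Lemma twist_id1 p : twist idfun (tens p aone) = delta p.
Proof. by rewrite twistE tensor_map_id -/(tensor_one A H) amul1r. Qed.

(** p (x) h |-> p_0 phi (S (p_1) h) *)
Definition retraction (phi : {linear H -> A}) : tensor A H -> A :=
  @mul_map k A \o (tensor_map idfun phi \o twist (antipode H)).
HB.instance Definition _ phi := GRing.Linear.on (retraction phi).

(** The elements p_0 (x) p_1 h span A (x) H, and the retraction sends them to
    p phi h.  Checking its properties on them avoids the coproduct of the
    antipode. *)
Lemma retraction_twist phi t :
  retraction phi (twist idfun t) = mul_map (tensor_map idfun phi t).
Proof. by rewrite /retraction /= twist_idK. Qed.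

Lemma retraction_delta (phi : {linear H -> A}) p :
  phi aone = aone -> retraction phi (delta p) = p.
Proof.
by move=> phi1; rewrite -twist_id1 retraction_twist tensor_mapE phi1 mul_mapE amul1r.
Qed.

Section Modulo.
Variables (C : algebra k) (chi : {linear A -> C}).
Hypothesis chi_morphism : algebra_morphism chi.

(** Colinearity up to the ideal ker chi; exact colinearity is the case where
    chi is the identity. *)
Definition colinear_mod (X : lmodType k) (d : {linear X -> tensor X H})
    (f : {linear X -> A}) :=
  forall x, tensor_map chi idfun (delta (f x)) =
            tensor_map chi idfun (tensor_map f idfun (d x)).

Lemma retraction_colinear (phi : {linear H -> A}) :
  colinear_mod (comul H) phi ->
  colinear_mod (@tensorAV k A H H \o tensor_map idfun (comul H)) (retraction phi).
Proof.
move=> phi_colin t; rewrite -(twist_antipodeK t); move: (twist (antipode H) t) => {}t.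
elim/tens_ind: t => [p h|s t IHs IHt]; last by rewrite !linearD /= IHs IHt.
rewrite /= retraction_twist tensor_mapE mul_mapE delta_morphism.2 /=.
rewrite tensor_map_mull // phi_colin -tensor_map_mull // twistE tensor_map_id.
congr (tensor_map chi idfun _).
have -> : tensorAV (tensor_map idfun (comul H) (delta p ** tens aone h)) =
          tensor_map delta idfun (delta p) ** tensorAV (tens aone (comul H h)).
  rewrite -(tensorAK (tensor_map delta idfun _)) delta_coaction.1 /=.
  elim/tens_ind: (delta p) => [q x|s t IHs IHt].
    rewrite tensM !tensor_mapE /= (comul_morphism H).2 tensorAVM.
    by rewrite amul1r.
  by rewrite amulDl !linearD /= IHs IHt amulDl.
elim/tens_ind: (delta p) => [q x|s t IHs IHt]; last first.
  by rewrite linearD /= !amulDl linearD /= IHs IHt.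
elim/tens_ind: (comul H h) => [y z|s t IHs IHt]; last first.
  by rewrite tensDr !linearD /= !amulDr linearD /= IHs IHt.
rewrite tensorAVE !tensor_mapE tensM tensM tensor_mapE /=.
rewrite -[delta q]tensor_map_id -twistE.
by rewrite retraction_twist tensor_mapE mul_mapE.
Qed.

(** The kernel of chi is an ideal and, by hypothesis, a subcomodule, so the
    formula p_0 phi (S (p_1) h) does not leave it. *)
Lemma retraction_ker (phi : {linear H -> A}) :
  (forall p, chi p = 0 -> tensor_map chi idfun (delta p) = 0) ->
  forall t, tensor_map chi idfun t = 0 -> chi (retraction phi t) = 0.
Proof.
move=> chi_delta t t0.
apply: (tensor_exact1 (G := chi \o retraction phi) _ t0) => p h /chi_delta p0.
transitivity (chi (mul_map (tensor_map idfun phi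
                (tensor_map idfun (antipode H) (delta p) ** tens aone h)))).
  by rewrite -twistE.
rewrite mul_map_morphism // tensor_map_comp.
set s := _ ** _.
have s0 : tensor_map chi idfun s = 0.
  rewrite /s tensor_map_mull //.
  suff -> : tensor_map chi idfun (tensor_map idfun (antipode H) (delta p)) = 0.
    exact: amul0l.
  transitivity (tensor_map idfun (antipode H) (tensor_map chi idfun (delta p))).
    by rewrite !tensor_map_comp; apply: eq_tensor_map.
  by rewrite p0 linear0.
transitivity (mul_map (tensor_map idfun (chi \o phi) (tensor_map chi idfun s))).
  by rewrite tensor_map_comp; congr mul_map; apply: eq_tensor_map.
by rewrite s0 !linear0.
Qed.

End Modulo.
End ComoduleAlgebra.

(** * Total integrals from local trivialisations *)

Section TotalIntegral.
Variables (k : fieldType) (H : hopfAlgebra k) (A : algebra k).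
Variable delta : {linear A -> tensor A H}.
Hypothesis delta_coaction : right_coaction delta.
Hypothesis delta_morphism : algebra_morphism delta.
Variables (I : finType) (B : I -> algebra k).
Variable chi : forall i, {linear A -> tensor (B i) H}.
Hypothesis chi_morphism : forall i, algebra_morphism (chi i).
Hypothesis chi_surj : forall i y, exists p, chi i p = y.
Hypothesis chi_delta : forall i p,
  tensorA (tensor_map (chi i) idfun (delta p)) =
  tensor_map idfun (comul H) (chi i p).
Hypothesis chi_inj : forall p, (forall i, chi i p = 0) -> p = 0.

Lemma chi_section i :
  exists s : {linear tensor (B i) H -> A}, forall y, chi i (s y) = y.
Proof.
have [s sK] := ex_pseudo_inverse (chi i); exists s => y.
by have [p <-] := chi_surj y; rewrite sK.
Qed.

Lemma chi_lift1 i :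
  exists w : {linear H -> A}, forall h, chi i (w h) = tens aone h.
Proof.
have [s sK] := chi_section i.
have [|w wE] := @ex_linear k H A (fun h => s (tens aone h)).
  by move=> a x y; rewrite tensDr tensZr linearP.
by exists w => h; rewrite wE sK.
Qed.

Lemma ker_chi_delta i p : chi i p = 0 -> tensor_map (chi i) idfun (delta p) = 0.
Proof. by move=> p0; rewrite -[LHS]tensorAK chi_delta p0 !linear0. Qed.

(** The ideal ker chi_i is a direct summand of A up to colinearity modulo the
    indices where an integral phi is known: take a linear projection r0 onto the
    ideal and average it, r = lam (r0 (x) id) delta. *)
Lemma ker_chi_projection i (s : seq I) (phi : {linear H -> A}) :
  phi aone = aone ->
  (forall j, j \in s -> colinear_mod delta (chi j) (comul H) phi) ->
  exists r : {linear A -> A},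
    [/\ forall p, chi i (r p) = 0, forall p, chi i p = 0 -> r p = p &
        forall j, j \in s -> colinear_mod delta (chi j) delta r].
Proof.
move=> phi1 phi_colin; have [sg sgK] := chi_section i.
pose r0 : {linear A -> A} := idfun \- (sg \o chi i).
have r0chi p : chi i (r0 p) = 0 by rewrite /r0 /= linearB /= sgK subrr.
pose lam : {linear tensor A H -> A} := retraction delta phi.
pose r : {linear A -> A} := lam \o (tensor_map r0 idfun \o delta).
have rE p : r p = lam (tensor_map r0 idfun (delta p)) by [].
exists r; split=> [p|p|j js p].
- rewrite rE; apply: retraction_ker => // [q|]; first exact: ker_chi_delta.
  rewrite -tensor_map_compl; elim/tens_ind: (delta p) => [q h|t t' IHt IHt'].
    by rewrite tensor_mapE [X in tens X _](r0chi q) linear0l.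
  by rewrite linearD /= IHt IHt' addr0.
- move=> /ker_chi_delta p0; rewrite rE.
  have -> : tensor_map r0 idfun (delta p) = delta p.
    by rewrite tensor_mapBl tensor_map_id tensor_map_compl p0 linear0 subr0.
  exact: retraction_delta.
- rewrite rE (retraction_colinear _ _ _ (phi_colin j js)) //.
  congr (tensor_map _ _ _); rewrite [RHS]tensor_map_compl; congr (tensor_map _ _ _).
  rewrite /= tensor_map_compl -[tensor_map delta _ _]tensorAK delta_coaction.1.
  rewrite -tensorAV_map !tensor_map_comp; congr tensorAV.
  by apply: eq_tensor_map => // h /=; rewrite tensor_map_id.
Qed.

(** The local integral h |-> 1 (x) h of B_i (x) H lifts linearly to w.  With the
    projection r onto ker chi_i, the map gam = (1 - r) w is colinear: modulo
    ker chi_i because chi_i gam h = 1 (x) h, modulo the earlier indices because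
    1 - r kills the defect of w, which lies in ker chi_i (x) H.  Its defect of
    unitality x = 1 - gam 1 is in ker chi_i and is coinvariant modulo the
    earlier indices, so that adding x phi restores unitality without spoiling
    colinearity. *)
Lemma total_integral_step i (s : seq I) (phi : {linear H -> A}) :
  phi aone = aone ->
  (forall j, j \in s -> colinear_mod delta (chi j) (comul H) phi) ->
  exists phi' : {linear H -> A}, phi' aone = aone /\
    forall j, j \in i :: s -> colinear_mod delta (chi j) (comul H) phi'.
Proof.
move=> phi1 phi_colin; have [w wE] := chi_lift1 i.
have [r [r_chi r_id r_colin]] := ker_chi_projection i phi1 phi_colin.
have [gam gamE] : exists gam : {linear H -> A}, forall h, gam h = w h - r (w h).
  by exists (w \- (r \o w)).
have gam_chi h : chi i (gam h) = tens aone h.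
  by rewrite gamE linearB wE r_chi subr0.
have gam_colin j : j \in s -> colinear_mod delta (chi j) (comul H) gam.
  move=> js h; rewrite gamE !linearB /= (r_colin j js) -!linearB.
  congr (tensor_map (chi j) idfun _).
  pose z := delta (w h) - tensor_map w idfun (comul H h).
  have /eqP : tensor_map (idfun \- r) idfun z = 0.
    apply: (@tensor_ker_le _ _ _ _ _ (chi i)) => [p /= /r_id->|].
      exact: subrr.
    rewrite linearB /= -[X in X - _]tensorAK chi_delta wE tensor_mapE.
    apply/eqP; rewrite subr_eq0; apply/eqP.
    rewrite -tensor_map_compl /=.
    elim/tens_ind: (comul H h) => [x y|t t' IHt IHt'].
      by rewrite tensorAVE tensor_mapE /= wE.
    by rewrite tensDr !linearD /= IHt IHt'.
  rewrite /z linearB subr_eq0 /= => /eqP zE.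
  rewrite -[X in X - _]tensor_map_id -tensor_mapBl zE -tensor_map_compl.
  by apply: eq_tensor_map => // y; rewrite gamE.
pose x := aone - gam aone.
have x_chi : chi i x = 0.
  by rewrite linearB gam_chi (chi_morphism i).1 subrr.
have [phi' phi'E] : exists phi' : {linear H -> A},
    forall h, phi' h = gam h + x ** phi h.
  by exists (gam \+ (lmul x \o phi)).
exists phi'; split; first by rewrite phi'E phi1 amul1r addrC subrK.
move=> j; rewrite inE => /predU1P[->|js] h.
  have phi'_chi y : chi i (phi' y) = tens aone y.
    by rewrite phi'E linearD gam_chi (chi_morphism i).2 x_chi amul0l addr0.
  rewrite -[LHS]tensorAK chi_delta phi'_chi -tensor_map_compl tensor_mapE.
  elim/tens_ind: (comul H h) => [y z|t t' IHt IHt'].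
    by rewrite tensorAVE tensor_mapE /= phi'_chi.
  by rewrite tensDr !linearD /= IHt IHt'.
have x_delta : tensor_map (chi j) idfun (delta x) = tens (chi j x) aone.
  rewrite !linearB /= gam_colin // delta_morphism.1 (comul_morphism H).1.
  by rewrite !tensor_mapE /= linearBl.
clearbody x.
rewrite phi'E !linearD /= gam_colin // delta_morphism.2 tensor_map_mull //.
rewrite x_delta phi_colin //.
have -> : tensor_map phi' idfun (comul H h) =
    tensor_map (gam \+ (lmul x \o phi)) idfun (comul H h).
  by apply: eq_tensor_map => // y; rewrite phi'E.
rewrite tensor_mapDl [RHS]linearD; congr (_ + _).
elim/tens_ind: (comul H h) => [y z|t t' IHt IHt'].
  by rewrite !tensor_mapE tensM /= tensor_mapE /= /lmul (chi_morphism j).2 amul1l.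
by rewrite !linearD /= amulDr IHt IHt'.
Qed.

(** The induction starts with h |-> eps (h) 1, colinear modulo no index at all;
    at the end colinearity modulo all chi_i is colinearity, since the chi_i are
    jointly injective and stay so after tensoring with H. *)
Lemma ex_total_integral :
  exists phi : {linear H -> A}, phi aone = aone /\
    forall h, delta (phi h) = tensor_map phi idfun (comul H h).
Proof.
have [phi [phi1 phi_colin]] : exists phi : {linear H -> A}, phi aone = aone /\
    forall j, j \in enum I -> colinear_mod delta (chi j) (comul H) phi.
  elim: (enum I) => [|i s [phi [phi1 phi_colin]]].
    have [|phi phiE] := @ex_linear k H A (fun h => (counit H h : k) *: aone).
      by move=> a x y; rewrite linearP scalerDl scalerA.
    by exists phi; split=> //; rewrite phiE (counit_morphism H).1 scale1r.
  exact: total_integral_step phi1 phi_colin.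
exists phi; split=> // h; apply/subr0_eq.
apply: (tensor_exact (f := chi) (G := idfun)) => [p y p0|i] /=.
  by rewrite (chi_inj p0) linear0l.
by rewrite linearB /= phi_colin ?mem_enum // subrr.
Qed.

Lemma ex_colinear_retraction :
  exists lam : {linear tensor A H -> A},
    [/\ forall p, lam (delta p) = p,
        forall t, delta (lam t) =
          tensor_map lam idfun (tensorAV (tensor_map idfun (comul H) t)) &
        forall i t, tensor_map (chi i) idfun t = 0 -> chi i (lam t) = 0].
Proof.
have [phi [phi1 phi_colin]] := ex_total_integral.
exists (retraction delta phi); split=> [p|t|i t t0].
- exact: retraction_delta.
- rewrite -[LHS]tensor_map_id -[RHS]tensor_map_id.
  apply: (retraction_colinear delta_coaction delta_morphism) => // h.
  by rewrite phi_colin.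
- by apply: retraction_ker t0 => // p; exact: ker_chi_delta.
Qed.

Section FibreCounit.
Variable i : I.

Definition chi_counit : A -> B i :=
  @tensor1r k (B i) \o (tensor_map idfun (counit H) \o chi i).
HB.instance Definition _ := GRing.Linear.on chi_counit.

Lemma chi_counitE p : chi_counit p = tensor1r (tensor_map idfun (counit H) (chi i p)).
Proof. by []. Qed.

(** Apply the counit to the middle factor of the colinearity equation of
    chi_i. *)
Lemma chi_of_counit p : chi i p = tensor_map chi_counit idfun (delta p).
Proof.
pose e : {linear tensor (B i) H -> B i} :=
  @tensor1r k (B i) \o tensor_map idfun (counit H).
transitivity (tensor_map e idfun (tensorAV (tensor_map idfun (comul H) (chi i p)))).
  elim/tens_ind: (chi i p) => [b h|s t IHs IHt].
    rewrite tensor_mapE /= -{1}[h]counitl.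
    elim/tens_ind: (comul H h) => [x y|s t IHs IHt].
      by rewrite tensorAVE !tensor_mapE /= tensor_mapE tensor1lE tensor1rE tensZl tensZr.
    by rewrite !linearD /= !tensDr !linearD /= -IHs -IHt.
  by rewrite !linearD /= -IHs -IHt.
rewrite -chi_delta tensorAK -tensor_map_compl.
exact: eq_tensor_map.
Qed.

Lemma chi_counit_mul a b p :
  chi i a = tens b aone -> chi_counit (a ** p) = b ** chi_counit p.
Proof.
move=> ab; rewrite !chi_counitE (chi_morphism i).2 ab.
elim/tens_ind: (chi i p) => [c h|s t IHs IHt].
  by rewrite tensM amul1l !tensor_mapE !tensor1rE amulZr.
by rewrite amulDr !linearD /= amulDr IHs IHt.
Qed.

End FibreCounit.
End TotalIntegral.

(** * The total algebra of a principal bundle *)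

Section PrincipalBundle.
Variables (k : fieldType) (I : finType) (P : locally_trivial_QPFB k I).
Local Notation A := (qpfb_total P).
Local Notation H := (qpfb_hopf P).
Local Notation J := (qpfb_ideal P).
Local Notation iota := (qpfb_iota P).
Local Notation delta := (qpfb_coact P).
Local Notation chi := (@qpfb_chi k I P).

Definition base_part (i : I) : A -> quotv (J i) :=
  @chi_counit k H A I (fun i => quot_algebra (J i)) chi i.
HB.instance Definition _ i := GRing.Linear.on (base_part i).

Lemma chi_inj p : (forall i, chi i p = 0) -> p = 0.
Proof.
by move=> p0; apply: (qpfb_total_covering P).1 => i; rewrite kersubE p0.
Qed.

Lemma qpfb_colinear_retraction :
  exists lam : {linear tensor A H -> A},
    [/\ forall p, lam (delta p) = p,
        forall t, delta (lam t) =
          tensor_map lam idfun (tensorAV (tensor_map idfun (comul H) t)) &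
        forall i t, tensor_map (chi i) idfun t = 0 -> chi i (lam t) = 0].
Proof.
apply: (@ex_colinear_retraction k H A delta _ _ I (fun i => quot_algebra (J i))).
- exact: qpfb_coactP.
- exact: qpfb_coact_morphism.
- exact: qpfb_chi_morphism.
- exact: qpfb_chi_surj.
- exact: qpfb_chi_coact.
- exact: chi_inj.
Qed.

Lemma chi_base_part i p : chi i p = tensor_map (base_part i) idfun (delta p).
Proof.
by apply: (@chi_of_counit k H A delta I (fun i => quot_algebra (J i)) chi);
   exact: qpfb_chi_coact.
Qed.

Lemma base_part_chi i p :
  base_part i p = tensor1r (tensor_map idfun (counit H) (chi i p)).
Proof. by []. Qed.

Lemma base_part_eq0 i p : chi i p = 0 -> base_part i p = 0.
Proof. by move=> p0; rewrite base_part_chi p0 !linear0. Qed.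

Lemma base_part_iotaM i a p :
  base_part i (iota a ** p) = (qproj (J i) a : quot_algebra (J i)) ** base_part i p.
Proof.
apply: (@chi_counit_mul k H A I (fun i => quot_algebra (J i)) chi) => //.
  exact: qpfb_chi_morphism.
exact: qpfb_chi_iota.
Qed.

Lemma base_part_iota i a : base_part i (iota a) = qproj (J i) a.
Proof.
rewrite base_part_chi qpfb_chi_iota tensor_mapE tensor1rE.
by rewrite (counit_morphism H).1 scale1r.
Qed.

(** The element p_0 w (S (p_1)) plays the role of the coinvariant part of p:
    under chi_i it becomes beta (p_0) (x) p_1 S (p_2) = beta (p) (x) 1. *)
Lemma coinvariant_antipode i p (w : {linear H -> A}) :
  (forall h, chi i (w h) = tens (aone : quot_algebra (J i)) h) ->
  chi i (mul_map (tensor_map idfun (w \o antipode H) (delta p))) =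
  tens (base_part i p) aone.
Proof.
move=> wE; rewrite mul_map_morphism; last exact: qpfb_chi_morphism.
have [|f fE] := @ex_linear k H (tensor (quot_algebra (J i)) H)
    (fun h => tens aone (antipode H h)).
  by move=> a x y; rewrite linearP tensDr tensZr.
transitivity (mul_map (tensor_map idfun f (tensor_map (chi i) idfun (delta p)))).
  rewrite !tensor_map_comp; congr mul_map; apply: eq_tensor_map => // h /=.
  by rewrite fE wE.
rewrite -[tensor_map (chi i) _ _]tensorAK qpfb_chi_coact base_part_chi.
elim/tens_ind: (chi i p) => [b h|s t IHs IHt]; last first.
  by rewrite !linearD /= tensDl -IHs -IHt.
rewrite !tensor_mapE /= tensor1rE tensZl -tensZr -antipoder.
elim/tens_ind: (comul H h) => [x y|s t IHs IHt].
  by rewrite tensorAVE !tensor_mapE /= !mul_mapE fE tensM /= amul1r.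
by rewrite tensDr !linearD tensDr -IHs -IHt.
Qed.

(** With q = p_0 w (S (p_1)) in ker chi_j and a a lift of beta_i p, the element
    iota a - q is in ker chi_i, so that iota a is a coinvariant element of
    ker chi_i + ker chi_j.  The map y |-> lam (y (x) 1) projects onto the
    coinvariants and preserves both ideals: it splits iota a into coinvariant
    summands, that is a into a summand in J_i and one in J_j. *)
Lemma ker_chi_base_part i j p :
  chi j p = 0 -> exists a, a \in J j /\ qproj (J i) a = base_part i p.
Proof.
move=> p0; have [lam [lam_delta delta_lam lam_ker]] := qpfb_colinear_retraction.
have [w wE] := @chi_lift1 k H A I (fun i => quot_algebra (J i)) chi
  (@qpfb_chi_surj k I P) i.
pose q := mul_map (tensor_map idfun (w \o antipode H) (delta p)).
have q_i : chi i q = tens (base_part i p) aone by apply: coinvariant_antipode.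
have q_j : chi j q = 0.
  rewrite /q mul_map_morphism; last exact: qpfb_chi_morphism.
  transitivity (mul_map (tensor_map idfun (chi j \o (w \o antipode H))
                          (tensor_map (chi j) idfun (delta p)))).
    by rewrite !tensor_map_comp; congr mul_map; apply: eq_tensor_map.
  rewrite -[tensor_map (chi j) _ _]tensorAK qpfb_chi_coact p0.
  by rewrite !linear0.
have lam1 y : exists a, iota a = lam (tens y aone).
  apply/qpfb_iota_image; rewrite delta_lam tensor_mapE (comul_morphism H).1.
  by rewrite tensorAVE tensor_mapE.
have lam1_ker l y : chi l y = 0 -> chi l (lam (tens y aone)) = 0.
  by move=> y0; apply: lam_ker; rewrite tensor_mapE y0 linear0l.
pose a := qrepr (base_part i p).
have [a1 a1E] := lam1 (iota a - q); have [a2 a2E] := lam1 q.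
exists a2; split.
  rewrite -qproj_eq0 -base_part_iota a2E base_part_eq0 //.
  exact: lam1_ker.
rewrite -[RHS]qproj_repr; apply/eqP; rewrite eq_sym -subr_eq0 -linearB -/a.
have -> : a - a2 = a1.
  apply: (@qpfb_iota_inj k I P); rewrite linearB a1E a2E linearBl linearB.
  rewrite -[X in X - _ = _]lam_delta.
  by have /qpfb_iota_image-> : exists a', iota a' = iota a by exists a.
rewrite /= -base_part_iota a1E base_part_eq0 //; apply: lam1_ker.
by rewrite linearB qpfb_chi_iota q_i qproj_repr subrr.
Qed.

End PrincipalBundle.

(** * The associated bundle *)

Section AssociatedBundleTheory.
Variables (k : fieldType) (I : finType) (P : locally_trivial_QPFB k I).
Variables (F : lmodType k) (rho : {linear F -> tensor (qpfb_hopf P) F}).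
Hypothesis rho_coaction : left_coaction rho.
Local Notation A := (qpfb_total P).
Local Notation H := (qpfb_hopf P).
Local Notation J := (qpfb_ideal P).
Local Notation iota := (qpfb_iota P).
Local Notation delta := (qpfb_coact P).
Local Notation chi := (@qpfb_chi k I P).
Local Notation E := (assoc_bundle rho).

Lemma assocP (e : tensor A F) :
  reflect (tensorA (tensor_map delta idfun e) = tensor_map idfun rho e)
          (e \in assocp rho).
Proof. exact: eqP. Qed.

(** T = (lam (x) id) (id (x) rho).  The last property says that T only moves an
    element within ker chi_i (x) F if it satisfies the equation of E modulo
    chi_i; it is what lifts elements of (B_i (x) H) (x) F to E. *)
Lemma ex_assoc_projection :
  exists T : {linear tensor A F -> tensor A F},
    [/\ forall e, T e \in assocp rho,
        forall e, e \in assocp rho -> T e = e,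
        forall i e, tensor_map (chi i) idfun e = 0 ->
          tensor_map (chi i) idfun (T e) = 0 &
        forall i e,
          tensor_map (chi i) idfun (tensorA (tensor_map delta idfun e)) =
          tensor_map (chi i) idfun (tensor_map idfun rho e) ->
          tensor_map (chi i) idfun (T e) = tensor_map (chi i) idfun e].
Proof.
have [lam [lam_delta delta_lam lam_ker]] := qpfb_colinear_retraction P.
have [L LE] : exists L : {linear tensor A (tensor H F) -> tensor A F},
    forall z, L z = tensor_map lam idfun (tensorAV z).
  by exists (tensor_map lam idfun \o @tensorAV k A H F).
have L_ker i z : tensor_map (chi i) idfun z = 0 -> tensor_map (chi i) idfun (L z) = 0.
  apply: (tensor_exact1 (G := tensor_map (chi i) idfun \o L)) => p t p0 /=.
  elim/tens_ind: t => [h f|s t IHs IHt]; last first.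
    by rewrite tensDr !linearD /= IHs IHt addr0.
  rewrite LE tensorAVE !tensor_mapE /= lam_ker ?linear0l //.
  by rewrite tensor_mapE p0 linear0l.
have L_delta e : L (tensorA (tensor_map delta idfun e)) = e.
  rewrite LE tensorAK -tensor_map_compl -[RHS]tensor_map_id.
  by apply: eq_tensor_map => // p /=; rewrite lam_delta.
exists (L \o tensor_map idfun rho); split=> [e|e /assocP eP|i e e0|i e e_eq] /=.
- elim/tens_ind: e => [p f|s t IHs IHt]; last first.
    by rewrite !linearD rpredD.
  apply/assocP; rewrite tensor_mapE /=.
  have LA t : tensorA (tensor_map delta idfun (L (tens p t))) =
      tensor_map lam idfun
        (tensorAV (tens p (tensorA (tensor_map (comul H) idfun t)))).
    elim/tens_ind: t => [h g|s t IHs IHt]; last first.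
      by rewrite !(tensDr, linearD) /= -IHs -IHt.
    rewrite LE tensorAVE !tensor_mapE /= delta_lam tensor_mapE /=.
    elim/tens_ind: (comul H h) => [x y|s t IHs IHt].
      by rewrite tensorAVE tensor_mapE !tensorAE /= tensorAVE tensor_mapE.
    by rewrite tensDr !linearD /= !tensDl !linearD /= tensDr !linearD /= IHs IHt.
  have LR t : tensor_map idfun rho (L (tens p t)) =
      tensor_map lam idfun (tensorAV (tens p (tensor_map idfun rho t))).
    elim/tens_ind: t => [h g|s t IHs IHt]; last first.
      by rewrite !(tensDr, linearD) /= -IHs -IHt.
    rewrite LE tensorAVE !tensor_mapE /=.
    elim/tens_ind: (rho g) => [x y|s t IHs IHt].
      by rewrite tensorAVE tensor_mapE.
    by rewrite !tensDr !linearD /= -IHs -IHt.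
  by rewrite LA LR rho_coaction.1.
- by rewrite -eP L_delta.
- rewrite L_ker //.
  transitivity (tensor_map idfun rho (tensor_map (chi i) idfun e)).
    by rewrite !tensor_map_comp; apply: eq_tensor_map.
  by rewrite e0 linear0.
- apply/subr0_eq; rewrite -[in X in _ - X](L_delta e) -!linearB.
  by apply: L_ker; rewrite linearB /= e_eq subrr.
Qed.

(** On E the defining equation turns chi_i = (beta_i (x) id) delta into
    chi_i (x) id = (id (x) rho) (beta_i (x) id), up to associativity. *)
Lemma chi_assoc i e : e \in assocp rho ->
  tensorA (tensor_map (chi i) idfun e) =
  tensor_map idfun rho (tensor_map (base_part i) idfun e).
Proof.
move/assocP => eE.
transitivity (tensor_map (base_part i) idfun (tensorA (tensor_map delta idfun e))).
  transitivity (tensor_map (base_part i) (tensor_map idfun idfun)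
                  (tensorA (tensor_map delta idfun e))); last first.
    by apply: eq_tensor_map => // t; exact: tensor_map_id.
  rewrite -tensorA_map tensor_map_comp; congr tensorA.
  by apply: eq_tensor_map => // p; exact: chi_base_part.
by rewrite eE !tensor_map_comp; apply: eq_tensor_map.
Qed.

Lemma ker_base_part_assoc i e : e \in assocp rho ->
  tensor_map (base_part i) idfun e = 0 <-> tensor_map (chi i) idfun e = 0.
Proof.
move=> eP; split; last by apply: tensor_ker_le; exact: base_part_eq0.
by move=> e0; rewrite -[LHS]tensorAK chi_assoc // e0 !linear0.
Qed.

(** The element y' = (id (x) rho) y satisfies the equation that defines E, with
    B_i (x) H in place of A, by coassociativity of rho.  T corrects any linear
    lift of y' to an element of E with the same image, and the counit of rho
    recovers y from y'. *)
Lemma base_part_assoc_surj i (y : tensor (quotv (J i)) F) :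
  exists2 e, e \in assocp rho & tensor_map (base_part i) idfun e = y.
Proof.
have [T [T_assoc _ _ T_chi]] := ex_assoc_projection.
have [s sK] := @chi_section k H A I (fun i => quot_algebra (J i)) chi
  (@qpfb_chi_surj k I P) i.
pose y' := tensorAV (tensor_map idfun rho y).
have y'_cot :
    tensorA (tensor_map (@tensorAV k (quotv (J i)) H H \o
                           tensor_map idfun (comul H)) idfun y') =
    tensor_map idfun rho y'.
  rewrite /y'; elim/tens_ind: y {y'} => [b f|t t' IHt IHt']; last first.
    by rewrite !linearD /= IHt IHt'.
  rewrite tensor_mapE /=.
  transitivity (tensorAV (tens b (tensorA (tensor_map (comul H) idfun (rho f))))).
    elim/tens_ind: (rho f) => [h g|t t' IHt IHt']; last first.
      by rewrite tensDr !linearD /= tensDr !linearD /= -IHt -IHt'.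
    rewrite tensorAVE !tensor_mapE /= tensor_mapE /=.
    elim/tens_ind: (comul H h) => [x z|t t' IHt IHt'].
      by rewrite tensorAVE !tensorAE tensorAVE.
    by rewrite !(tensDr, linearD) /= !(tensDl, linearD) /=
               !(tensDr, linearD) /= IHt IHt'.
  rewrite rho_coaction.1.
  elim/tens_ind: (rho f) => [h g|t t' IHt IHt'].
    rewrite tensorAVE !tensor_mapE /=.
    elim/tens_ind: (rho g) => [x z|t t' IHt IHt'].
      by rewrite tensorAVE.
    by rewrite !(tensDr, linearD) /= IHt IHt'.
  by rewrite !(tensDr, linearD) /= -IHt -IHt'.
pose e := tensor_map s idfun y'.
have e_chi : tensor_map (chi i) idfun e = y'.
  rewrite -tensor_map_compl -[RHS]tensor_map_id.
  by apply: eq_tensor_map => // t; exact: sK.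
exists (T e) => //.
have e' : tensor_map (chi i) idfun (T e) = y'.
  rewrite T_chi //.
  transitivity (tensor_map idfun rho (tensor_map (chi i) idfun e)); last first.
    by rewrite !tensor_map_comp; apply: eq_tensor_map.
  rewrite e_chi -y'_cot.
  transitivity (tensor_map (chi i) (tensor_map idfun idfun)
                  (tensorA (tensor_map delta idfun e))).
    by apply: eq_tensor_map => // t; rewrite [RHS]tensor_map_id.
  rewrite -tensorA_map tensor_map_comp -e_chi tensor_map_comp; congr tensorA.
  apply: eq_tensor_map => // p /=.
  by rewrite -qpfb_chi_coact tensorAK.
pose b : {linear tensor (quotv (J i)) H -> quotv (J i)} :=
  @tensor1r k (quotv (J i)) \o tensor_map idfun (counit H).
transitivity (tensor_map b idfun (tensor_map (chi i) idfun (T e))).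
  by rewrite -tensor_map_compl; apply: eq_tensor_map.
rewrite e' /y'.
elim/tens_ind: y {y' y'_cot e e_chi e'} => [c f|t t' IHt IHt']; last first.
  by rewrite !linearD /= IHt IHt'.
rewrite tensor_mapE /= -[f in RHS](rho_coaction.2).
elim/tens_ind: (rho f) => [h g|t t' IHt IHt'].
  by rewrite tensorAVE !tensor_mapE /= tensor_mapE tensor1rE tensor1lE tensZl tensZr.
by rewrite !(tensDr, linearD) /= IHt IHt'.
Qed.

Lemma trivialisation_proof i a (e : E) :
  tensor_map (base_part i) idfun (val (lm_act a e)) =
  trivial_act a (tensor_map (base_part i) idfun (val e)).
Proof.
rewrite /trivial_act /= /assoc_mul.
elim/tens_ind: (val e) => [p f|s t IHs IHt]; last first.
  by rewrite !linearD /= IHs IHt.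
by rewrite !tensor_mapE /= base_part_iotaM.
Qed.

Lemma ex_trivialisation :
  exists zeta : forall i, moduleHom E (trivial_module (J i) F),
    forall i (e : E), zeta i e = tensor_map (base_part i) idfun (val e).
Proof.
by exists (fun i => @ModuleHom k _ E (trivial_module (J i) F)
    (tensor_map (base_part i) idfun \o val) (trivialisation_proof i)).
Qed.

Variable zeta : forall i, moduleHom E (trivial_module (J i) F).
Hypothesis zetaE :
  forall i (e : E), zeta i e = tensor_map (base_part i) idfun (val e).

Lemma ker_zeta i (e : E) :
  zeta i e = 0 <-> tensor_map (chi i) idfun (val e) = 0.
Proof. by rewrite zetaE; apply/ker_base_part_assoc/(valP e). Qed.

Lemma zeta_surj i y : exists e, zeta i e = y.
Proof.
by have [e eP <-] := base_part_assoc_surj y; exists (exist _ e eP).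
Qed.

(** An element of B_i (x) F killed by f (x) id is a sum of tensors
    pi_i (a) (x) v with a in J_j, and it lifts to the elements a e_v, where e_v
    lifts 1 (x) v; these are in ker zeta_j because zeta_j is B-linear.  The
    map f is a parameter, so that both projections to B / (J_i + J_j) are
    covered. *)
Lemma ker_zeta_sum i j (X : lmodType k) (f : {linear quotv (J i) -> X}) :
  (forall a, f (qproj (J i) a) = 0 <-> a \in addsub (J i) (J j)) ->
  addsub (kersub (zeta i)) (kersub (zeta j)) =i
  kersub (tensor_map f idfun \o zeta i).
Proof.
move=> f_ker e; rewrite kersubE; apply/addsubP/eqP => [[e1 [e2 [e1K e2K ->]]]|e0].
  move: e1K e2K; rewrite !kersubE => /eqP e1_0 /eqP /ker_zeta e2_0.
  rewrite linearD /= e1_0 linear0 add0r zetaE -tensor_map_compl.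
  apply: tensor_ker_le e2_0 => p /(ker_chi_base_part i)[a [aJ /= <-]].
  by apply/f_ker/addsubr.
have [g gK] := ex_pseudo_inverse f.
have [n nE] : exists n : {linear quotv (J i) -> quotv (J i)},
    forall x, n x = x - g (f x) by exists (idfun \- (g \o f)).
have lift y : exists e', zeta i e' = tensor_map n idfun y /\
                         zeta j e' = 0.
  elim/tens_ind: y => [x v|s t [e1 [e1i e1j]] [e2 [e2i e2j]]]; last first.
    by exists (e1 + e2); rewrite !linearD /= e1i e2i e1j e2j addr0.
  have /addsubP[a1 [a2 [a1J a2J aE]]] : qrepr (n x) \in addsub (J i) (J j).
    by apply/f_ker; rewrite qproj_repr nE linearB gK subrr.
  have [ev evE] := zeta_surj (tens (qproj (J i) aone) v).
  exists (lm_act a2 ev); split.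
    rewrite mh_act evE /= /trivial_act !tensor_mapE /= /lmul -qprojM amul1r.
    rewrite -[n x]qproj_repr aE linearD /=.
    by have /eqP -> : qproj (J i) a1 == 0; rewrite ?qproj_eq0 // add0r.
  rewrite mh_act /= /trivial_act.
  elim/tens_ind: (zeta j ev) => [z u|s t IHs IHt]; last first.
    by rewrite linearD /= IHs IHt addr0.
  rewrite tensor_mapE /= /lmul.
  have /eqP -> : qproj (J j) a2 == 0; first by rewrite qproj_eq0.
  by rewrite (amul0l (A := quot_algebra (J j))) linear0l.
have [e' [e'i e'j]] := lift (zeta i e).
exists (e - e'), e'; rewrite !kersubE e'j eqxx subrK; split=> //.
rewrite linearB /= e'i (eq_tensor_map (f' := idfun \- (g \o f)) (g' := idfun)) //.
rewrite tensor_mapBl tensor_map_id tensor_map_compl.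
by move: e0 => /= ->; rewrite linear0 subr0 subrr.
Qed.

Lemma assoc_valD (u v : E) : val (u + v) = val u + val v.
Proof. exact: (raddfD (val : assoc_space rho -> _)). Qed.

Lemma assoc_valB (u v : E) : val (u - v) = val u - val v.
Proof. exact: (raddfB (val : assoc_space rho -> _)). Qed.

(** Glue in A (x) F, where the kernels of the maps chi_i (x) id form a complete
    covering, and project to E by T. *)
Lemma assoc_complete : complete_covering (fun i => kersub (zeta i)).
Proof.
have [T [T_assoc T_id T_ker _]] := ex_assoc_projection.
apply/complete_coveringP; split=> [e e0|x x_compat].
  apply: val_inj; apply: (tensor_exact (f := chi) (G := idfun)) => [p v p0|i] /=.
    by rewrite (chi_inj p0) linear0l.
  by apply/ker_zeta/eqP; rewrite -kersubE.
have [|t tE] := @tensor_glue k I A F (fun i => kersub (chi i))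
                  (fun i => val (x i)) (qpfb_total_covering P).
  move=> i j; have /addsubP[e1 [e2 [e1K e2K e12]]] := x_compat i j.
  rewrite -assoc_valB e12 assoc_valD linearD /=.
  move: e1K e2K; rewrite !kersubE => /eqP /ker_zeta e1_0 /eqP /ker_zeta e2_0.
  rewrite (tensor_ker_le _ e1_0) => [|p p0]; last first.
    by apply/eqP; rewrite qproj_eq0 addsubl // kersubE p0.
  rewrite add0r (tensor_ker_le _ e2_0) // => p p0.
  by apply/eqP; rewrite qproj_eq0 addsubr // kersubE p0.
exists (exist _ (T t) (T_assoc t)) => i; rewrite kersubE; apply/eqP/ker_zeta.
rewrite assoc_valB /= -[val (x i)](T_id _ (valP (x i))) -linearB; apply: T_ker.
apply: tensor_ker_le (tE i) => p.
by move/eqP; rewrite qproj_eq0 kersubE => /eqP.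
Qed.

End AssociatedBundleTheory.

Section TrivialAction.
Variables (k : fieldType) (B : algebra k) (J : ideal B) (F : lmodType k).

(** Acting on 1 (x) f with f nonzero detects B / J. *)
Lemma trivial_act_eq0 (F_neq0 : exists f : F, f <> 0) b :
  (forall t : tensor (quotv J) F, trivial_act b t = 0) <-> b \in J.
Proof.
split=> [b0|bJ t].
  have [f f0] := F_neq0; have := b0 (tens (qproj J aone) f).
  rewrite /trivial_act tensor_mapE /= /lmul -qprojM amul1r => /(tens_eq0 f0)/eqP.
  by rewrite qproj_eq0.
rewrite /trivial_act; elim/tens_ind: t => [x f|s t IHs IHt]; last first.
  by rewrite linearD /= IHs IHt addr0.
rewrite tensor_mapE /= /lmul; have /eqP -> : qproj J b == 0 by rewrite qproj_eq0.
by rewrite (amul0l (A := quot_algebra J)) linear0l.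
Qed.

End TrivialAction.

Theorem proposition5 (k : fieldType) (I : finType)
    (P : locally_trivial_QPFB k I) (F : lmodType k)
    (F_neq0 : exists f : F, f <> 0)
    (rho : {linear F -> tensor (qpfb_hopf P) F})
    (rho_coaction : left_coaction rho) :
  exists zeta : forall i : I,
      moduleHom (assoc_bundle rho) (trivial_module (qpfb_ideal P i) F),
    locally_trivial_QVB zeta.
Proof.
have [zeta zetaE] := ex_trivialisation rho; exists zeta.
have surj := zeta_surj rho_coaction zetaE.
have kerJ i b : (forall e, zeta i (lm_act b e) = 0) <-> b \in qpfb_ideal P i.
  rewrite -(trivial_act_eq0 _ F_neq0); split=> b0 t; last first.
    by rewrite mh_act; exact: b0.
  by have [e <-] := surj i t; rewrite -[LHS](mh_act (zeta i)) b0.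
split.
- move=> b /ker_actP b0; apply: (qpfb_base_covering P).1 => i.
  by apply/kerJ => e; rewrite b0 linear0.
- exact: qpfb_base_covering.
- exact: surj.
- split; last exact: (assoc_complete rho_coaction zetaE).
  apply: eq_complete_covering (qpfb_base_covering P) => i b.
  apply/idP/ker_actP => [/kerJ b0 x|b0].
    rewrite -[x]qproj_repr /= quot_actE; apply/eqP.
    by rewrite qproj_eq0 kersubE b0.
  apply/kerJ => e; apply/eqP; rewrite -kersubE -qproj_eq0.
  have := b0 (qproj _ e); rewrite /= quot_actE => ->.
  exact: eqxx.
- move=> i j; apply: (ker_zeta_sum rho_coaction zetaE) => a.
  by rewrite /= /projl qliftE; apply: (iff_trans (rwP eqP)); rewrite qproj_eq0.
- move=> i j e; rewrite addsubC.
  apply: (ker_zeta_sum rho_coaction zetaE) => a.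
  by rewrite /= /projr qliftE addsubC; apply: (iff_trans (rwP eqP)); rewrite qproj_eq0.
Qed.
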